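(* Let $(X,A)$ be a full Hilbert bimodule. Then the multiplier bimodule $(M(X),M(A))$ is an essential extension of $(X,A)$.
   Context: For a $C^*$-algebra $A$, a right Hilbert $A$-module is a Banach space $X$ with a non-degenerate right action of $A$ and an $A$-valued inner product $\langle\cdot,\cdot\rangle_X$ with $\langle \xi,\eta a\rangle_X=\langle\xi,\eta\rangle_X a$, $\langle\eta,\xi\rangle_X=\langle\xi,\eta\rangle_X^*$, $\langle\xi,\xi\rangle_X\ge 0$ and $\|\xi\|=\|\langle\xi,\xi\rangle_X\|^{1/2}$. A left Hilbert $A$-module is a Banach space with a non-degenerate left action of $A$ and an $A$-valued inner product ${}_X\langle\cdot,\cdot\rangle$ with ${}_X\langle a\xi,\eta\rangle=a\,{}_X\langle\xi,\eta\rangle$, ${}_X\langle\eta,\xi\rangle={}_X\langle\xi,\eta\rangle^*$, ${}_X\langle\xi,\xi\rangle\ge0$ and $\|\xi\|=\|{}_X\langle\xi,\xi\rangle\|^{1/2}$. The pair $(X,A)$ is a Hilbert bimodule if $X$ is simultaneously a left and a right Hilbert $A$-module and ${}_X\langle\xi,\eta\rangle\zeta=\xi\langle\eta,\zeta\rangle_X$ for all $\xi,\eta,\zeta\in X$. It is full if both ${}_X\langle X,X\rangle$ and $\langle X,X\rangle_X$ span dense subspaces of $A$ (i.e. $X$ is an imprimitivity bimodule). A morphism $(X,A)\to(Y,B)$ of Hilbert bimodules is a pair $(\psi_X,\psi_A)$ with $\psi_X:X\to Y$ linear and $\psi_A:A\to B$ a $*$-homomorphism such that $\psi_X(\xi a)=\psi_X(\xi)\psi_A(a)$,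 $\psi_X(a\xi)=\psi_A(a)\psi_X(\xi)$, $\psi_A(\langle\xi,\eta\rangle_X)=\langle\psi_X(\xi),\psi_X(\eta)\rangle_Y$ and $\psi_A({}_X\langle\xi,\eta\rangle)={}_Y\langle\psi_X(\xi),\psi_X(\eta)\rangle$. An ideal $I$ (closed, two-sided) of $A$ is invariant with respect to $X$ if $IX=XI$. A Hilbert bimodule $(Y,B)$ is an extension of $(X,A)$ if $B$ is a $C^*$-algebra containing $A$ as an ideal, there is a morphism of Hilbert bimodules $(\psi_X,\psi_A):(X,A)\to(Y,B)$ such that $\psi_A$ is the inclusion of $A$ in $B$, and $A$ is invariant with respect to $Y$. The extension is essential if $A$ is an essential ideal in $B$. Multiplier bimodule: $\mathcal L(\cdot,\cdot)$ denotes adjointable operators with respect to the right inner products, and $\mathcal K(X)$ is the closed span in $\mathcal L(X)$ of the operators $\theta_{\eta,\xi}(\zeta)=\eta\langle\xi,\zeta\rangle_X$. View $A$ as a Hilbert bimodule over itself by multiplication, with $\langle a,b\rangle_A=a^*b$ and ${}_A\langle a,b\rangle=ab^*$, and identify $M(A)=\mathcal L(A)$. Put $M(X):=\mathcal L(A,X)$. If $(X,A)$ is full, the left action $\phi(a)\xi=a\xi$ is an isomorphism $A\to\mathcal K(X)$ and extends to an isomorphism $\overline\phi:M(A)\to\mathcal L(X)$. Then $(M(X),M(A))$ is a Hilbert bimodule with right action given by composition, left action $(mT)(a)=\overline\phi(m)(T(a))$, right inner product $\langle S,T\rangle_{M(X)}=S^*T$ and left inner product ${}_{M(X)}\langle S,T\rangle=\overline\phi^{-1}(ST^*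 )$. The embedding of $(X,A)$ is $(\iota_X,\iota_A)$, $\iota_X(\xi)(b)=\xi b$, $\iota_A(a)(b)=ab$, and $A$ is identified with $\iota_A(A)\subset M(A)$. *)

(* Defs.v *)
From HB Require Import structures.
From mathcomp Require Import all_boot all_order all_algebra.
From mathcomp Require Import complex.
From mathcomp Require Import boolp classical_sets functions reals topology normedtype.

Set Implicit Arguments.
Unset Strict Implicit.
Unset Printing Implicit Defensive.

Import Order.TTheory GRing.Theory Num.Theory numFieldNormedType.Exports.
Local Open Scope classical_set_scope.
Local Open Scope ring_scope.

(* C*-algebras and Hilbert modules are given as raw data (a complex vector    *)
(* space, a real-valued norm and operations) together with Prop-valued        *)
(* records of axioms, so that "is a C*-algebra" and "is a Hilbert bimodule"   *)
(* can be asserted of concrete data such as M(A) and M(X).                    *)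

Section banach.
Variable R : realType.
Implicit Type V : lmodType R[i].

Definition normed_pack V (m : Lmodule_isNormed R[i] V) : normedModType R[i] :=
  HB.pack V m.

(* The library's norms on complex spaces take values in R[i]. *)
Definition is_banach V (nrm : V -> R) : Prop :=
  exists m : Lmodule_isNormed R[i] V,
    (forall x : normed_pack m, `|x| = (nrm x)%:C%C) /\
    (forall F : set_system (normed_pack m), ProperFilter F -> cauchy F -> cvg F).

Definition nclosure V (nrm : V -> R) (S : set V) : set V :=
  [set x | forall e : R, 0 < e -> exists2 s, S s & nrm (x - s) < e].

Definition linear_span V (S : set V) : set V :=
  [set x | exists n (c : 'I_n -> R[i]) (v : 'I_n -> V),
     (forall i, S (v i)) /\ x = \sum_(i < n) c i *: v i].

Definition closed_span V (nrm : V -> R) (S : set V) : set V :=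
  nclosure nrm (linear_span S).

End banach.

Section cstar.
Variable R : realType.

Record cstar_data := CstarData {
  cs_car :> lmodType R[i];
  cs_mul : cs_car -> cs_car -> cs_car;
  cs_star : cs_car -> cs_car;
  cs_norm : cs_car -> R }.

Record is_cstar (A : cstar_data) : Prop := IsCstar {
  cs_banach : is_banach (@cs_norm A);
  cs_mulA : associative (@cs_mul A);
  cs_mul_linearl : forall b : A, linear (fun a : A => cs_mul a b);
  cs_mul_linearr : forall a : A, linear (fun b : A => cs_mul a b);
  cs_normM : forall a b : A, cs_norm (cs_mul a b) <= cs_norm a * cs_norm b;
  cs_starD : forall a b : A, cs_star (a + b) = cs_star a + cs_star b;
  cs_starZ : forall (c : R[i]) (a : A), cs_star (c *: a) = c^* *: cs_star a;
  cs_starK : involutive (@cs_star A);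
  cs_starM : forall a b : A, cs_star (cs_mul a b) = cs_mul (cs_star b) (cs_star a);
  cs_norm_star : forall a : A, cs_norm (cs_mul (cs_star a) a) = cs_norm a ^+ 2 }.

Record cstarAlg := CstarAlg {
  cstar_of :> cstar_data;
  cstarP : is_cstar cstar_of }.

Definition cs_pos (A : cstar_data) (a : A) : Prop :=
  exists b : A, a = cs_mul (cs_star b) b.

Record is_star_hom (A B : cstar_data) (f : A -> B) : Prop := IsStarHom {
  sh_linear : linear f;
  sh_mul : forall a b : A, f (cs_mul a b) = cs_mul (f a) (f b);
  sh_star : forall a : A, f (cs_star a) = cs_star (f a) }.

Record is_ideal (A : cstar_data) (I : set A) : Prop := IsIdeal {
  id_0 : I 0;
  id_linear : forall (c : R[i]) (a b : A), I a -> I b -> I (c *: a + b);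
  id_closed : nclosure (@cs_norm A) I `<=` I;
  id_mull : forall a b : A, I b -> I (cs_mul a b);
  id_mulr : forall a b : A, I b -> I (cs_mul b a) }.

Definition is_essential_ideal (A : cstar_data) (I : set A) : Prop :=
  is_ideal I /\
  forall J : set A, is_ideal J -> J != [set 0] -> I `&` J != [set 0].

Record inner_productr (A : cstar_data) (X : lmodType R[i]) (ip : X -> X -> A)
    : Prop := InnerProductr {
  ipr_linear : forall x : X, linear (ip x);
  ipr_star : forall x y : X, ip y x = cs_star (ip x y) }.

Record right_hilbert (A : cstar_data) (X : lmodType R[i]) (nrm : X -> R)
    (act : X -> A -> X) (ip : X -> X -> A) : Prop := RightHilbert {
  rh_banach : is_banach nrm;
  rh_act_linearl : forall a : A, linear (fun x : X => act x a);
  rh_act_linearr : forall x : X, linear (act x);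
  rh_actM : forall (x : X) (a b : A), act x (cs_mul a b) = act (act x a) b;
  rh_nondeg : closed_span nrm [set act x a | x in setT & a in setT] = setT;
  rh_ip : inner_productr ip;
  rh_ip_act : forall (x y : X) (a : A), ip x (act y a) = cs_mul (ip x y) a;
  rh_ip_pos : forall x : X, cs_pos (ip x x);
  rh_norm : forall x : X, nrm x = Num.sqrt (cs_norm (ip x x)) }.

Record left_hilbert (A : cstar_data) (X : lmodType R[i]) (nrm : X -> R)
    (act : A -> X -> X) (ip : X -> X -> A) : Prop := LeftHilbert {
  lh_banach : is_banach nrm;
  lh_act_linearl : forall x : X, linear (fun a : A => act a x);
  lh_act_linearr : forall a : A, linear (act a);
  lh_actM : forall (a b : A) (x : X), act (cs_mul a b) x = act a (act b x);
  lh_nondeg : closed_span nrm [set act a x | a in setT & x in setT] = setT;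
  lh_ip_linear : forall y : X, linear (fun x : X => ip x y);
  lh_ip_star : forall x y : X, ip y x = cs_star (ip x y);
  lh_ip_act : forall (a : A) (x y : X), ip (act a x) y = cs_mul a (ip x y);
  lh_ip_pos : forall x : X, cs_pos (ip x x);
  lh_norm : forall x : X, nrm x = Num.sqrt (cs_norm (ip x x)) }.

Record bimod_data (A : cstar_data) := BimodData {
  bm_car :> lmodType R[i];
  bm_norm : bm_car -> R;
  ract : bm_car -> A -> bm_car;
  lact : A -> bm_car -> bm_car;
  rip : bm_car -> bm_car -> A;
  lip : bm_car -> bm_car -> A }.

Record is_hilbert_bimodule (A : cstar_data) (X : bimod_data A) : Prop :=
  IsHilbertBimodule {
  hb_right : right_hilbert (@bm_norm A X) (@ract A X) (@rip A X);
  hb_left : left_hilbert (@bm_norm A X) (@lact A X) (@lip A X);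
  hb_compat : forall x y z : X, lact (lip x y) z = ract x (rip y z) }.

Record hilbertBimod (A : cstarAlg) := HilbertBimod {
  hb_of :> bimod_data A;
  hbP : is_hilbert_bimodule hb_of }.

Definition full_bimodule (A : cstar_data) (X : bimod_data A) : Prop :=
  closed_span (@cs_norm A) [set lip x y | x in [set: X] & y in [set: X]] = setT /\
  closed_span (@cs_norm A) [set rip x y | x in [set: X] & y in [set: X]] = setT.

Record is_bimod_morphism (A B : cstar_data) (X : bimod_data A)
    (Y : bimod_data B) (psiX : X -> Y) (psiA : A -> B) : Prop :=
  IsBimodMorphism {
  bmm_linear : linear psiX;
  bmm_star_hom : is_star_hom psiA;
  bmm_ract : forall (x : X) (a : A), psiX (ract x a) = ract (psiX x) (psiA a);
  bmm_lact : forall (a : A) (x : X), psiX (lact a x) = lact (psiA a) (psiX x);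
  bmm_rip : forall x y : X, psiA (rip x y) = rip (psiX x) (psiX y);
  bmm_lip : forall x y : X, psiA (lip x y) = lip (psiX x) (psiX y) }.

(* I X and X I denote closed linear spans. *)
Definition invariant_ideal (A : cstar_data) (X : bimod_data A) (I : set A)
    : Prop :=
  closed_span (@bm_norm A X) [set lact a x | a in I & x in setT] =
  closed_span (@bm_norm A X) [set ract x a | x in setT & a in I].

(* (Y, B) is an extension of (X, A) by means of the morphism (psiX, psiA);    *)
(* the inclusion of A in B is the injective *-homomorphism psiA.              *)
Record is_extension (A B : cstar_data) (X : bimod_data A) (Y : bimod_data B)
    (psiX : X -> Y) (psiA : A -> B) : Prop := IsExtension {
  ext_cstar : is_cstar B;
  ext_bimod : is_hilbert_bimodule Y;
  ext_inj : injective psiA;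
  ext_morphism : is_bimod_morphism psiX psiA;
  ext_ideal : is_ideal (range psiA);
  ext_invariant : invariant_ideal Y (range psiA) }.

Definition is_essential_extension (A B : cstar_data) (X : bimod_data A)
    (Y : bimod_data B) (psiX : X -> Y) (psiA : A -> B) : Prop :=
  is_extension psiX psiA /\ is_essential_ideal (range psiA).

End cstar.

Section adjointable.
Variables (R : realType) (A : cstarAlg R).

(* The part of a right Hilbert module that adjointability depends on. *)
Record ipmod := Ipmod {
  ipm_car :> lmodType R[i];
  ipm_norm : ipm_car -> R;
  ipm_ip : ipm_car -> ipm_car -> A;
  ipmP : inner_productr ipm_ip }.

Section operators.
Variables E F : ipmod.

Definition adjoint_pair (T : E -> F) (S : F -> E) : Prop :=
  forall (x : E) (y : F), ipm_ip (T x) y = ipm_ip x (S y).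

Definition adjointable : pred (E -> F) :=
  fun T => `[< exists S, adjoint_pair T S >].

Lemma adjointable_submod : submod_closed adjointable.
Proof.
have st := @ipr_star _ _ _ _ (ipmP E); have stF := @ipr_star _ _ _ _ (ipmP F).
have li := @ipr_linear _ _ _ _ (ipmP E); have lF := @ipr_linear _ _ _ _ (ipmP F).
have ip0 : forall x : E, ipm_ip x 0 = 0 :> A.
  by move=> x; have := li x (-1) 0 0; rewrite scaler0 addr0 scaleN1r addNr.
have ip0F : forall y : F, ipm_ip y 0 = 0 :> A.
  by move=> x; have := lF x (-1) 0 0; rewrite scaler0 addr0 scaleN1r addNr.
have AP := cstarP A.
have star0 : cs_star (0 : A) = 0.
  by have := cs_starZ AP 0 0; rewrite !scale0r conjC0 scale0r.
split.
  apply/asboolP; exists (fun=> 0) => x y.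
  by rewrite ip0 stF ip0F star0.
move=> c T1 T2 /asboolP[S1 h1] /asboolP[S2 h2]; apply/asboolP.
exists (fun y => c^* *: S1 y + S2 y) => x y.
rewrite li -h1 -h2 stF lF (cs_starD AP) (cs_starZ AP).
by rewrite -!stF.
Qed.

HB.instance Definition _ :=
  GRing.isSubmodClosed.Build R[i] (E -> F) adjointable adjointable_submod.

(* The space L(E, F) of adjointable operators. *)
Record adj_op := AdjOp {
  adj_fun :> E -> F;
  adj_funP : adj_fun \in adjointable }.

HB.instance Definition _ := [isSub for adj_fun].
HB.instance Definition _ := [Choice of adj_op by <:].
HB.instance Definition _ := [SubChoice_isSubLmodule of adj_op by <:].

Lemma adj_opP (T : adj_op) : exists S, adjoint_pair T S.
Proof. exact/asboolP/adj_funP. Qed.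

Definition opnorm (T : E -> F) : R :=
  sup [set ipm_norm (T x) | x in [set x : E | ipm_norm x <= 1]].

End operators.

Lemma adjoint_pair_sym (E F : ipmod) (T : E -> F) (S : F -> E) :
  adjoint_pair T S -> adjoint_pair S T.
Proof.
move=> h x y.
by rewrite (ipr_star (ipmP E)) -h -(ipr_star (ipmP F)).
Qed.

Definition mk_adj (E F : ipmod) (T : E -> F) (S : F -> E)
    (h : adjoint_pair T S) : adj_op E F :=
  AdjOp (asboolT (ex_intro (adjoint_pair T) S h)).

Definition adj (E F : ipmod) (T : adj_op E F) : adj_op F E :=
  mk_adj (adjoint_pair_sym (projT2 (cid (adj_opP T)))).

Lemma adjointable_comp (E F G : ipmod) (S : adj_op F G) (T : adj_op E F) :
  (S \o T : E -> G) \in @adjointable E G.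
Proof.
have [S' hS] := adj_opP S; have [T' hT] := adj_opP T.
by apply/asboolP; exists (T' \o S') => x y /=; rewrite hS hT.
Qed.

Definition adj_comp (E F G : ipmod) (S : adj_op F G) (T : adj_op E F)
  : adj_op E G := AdjOp (adjointable_comp S T).

(* L(E) *)
Definition adj_alg (E : ipmod) : cstar_data R :=
  @CstarData R (adj_op E E) (@adj_comp E E E) (@adj E E) (@opnorm E E).

End adjointable.

Section multiplier.
Variables (R : realType) (A : cstarAlg R).

Lemma self_inner_productr :
  @inner_productr R A A (fun a b => cs_mul (cs_star a) b).
Proof.
have AP := cstarP A; split=> [x|x y]; first exact: (cs_mul_linearr AP).
by rewrite (cs_starM AP) (cs_starK AP).
Qed.

Definition self_mod : ipmod A := Ipmod (@cs_norm R A) self_inner_productr.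

(* M(A) = L(A) *)
Definition mult_alg : cstar_data R := adj_alg self_mod.

Lemma iotaA_adjoint (a : A) :
  @adjoint_pair R A self_mod self_mod (cs_mul a) (cs_mul (cs_star a)).
Proof.
by have AP := cstarP A; move=> x y /=; rewrite (cs_starM AP) (cs_mulA AP).
Qed.

Definition iotaA (a : A) : mult_alg := mk_adj (iotaA_adjoint a).

Variable X : hilbertBimod A.

Definition rmod : ipmod A :=
  Ipmod (@bm_norm R A X) (rh_ip (hb_right (hbP X))).

Lemma iotaX_adjoint (x : X) :
  @adjoint_pair R A self_mod rmod (ract x) (rip x).
Proof.
have AP := cstarP A; have XP := hb_right (hbP X).
move=> a y /=; rewrite (ipr_star (rh_ip XP)) (rh_ip_act XP) (cs_starM AP).
by rewrite -(ipr_star (rh_ip XP)).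
Qed.

Definition iotaX (x : X) : adj_op self_mod rmod := mk_adj (iotaX_adjoint x).

(* f is a *-isomorphism from M(A) onto L(X) extending phi : A -> K(X), where  *)
(* phi a is the operator x |-> a x. When X is full there is exactly one.      *)
Definition extends_phi (f : mult_alg -> adj_alg rmod) : Prop :=
  [/\ is_star_hom f, bijective f &
      forall (a : A) (x : X), f (iotaA a) x = lact a x].

Definition phibar : mult_alg -> adj_alg rmod := xget (fun=> 0) extends_phi.

Definition phibar_inv (u : adj_alg rmod) : mult_alg :=
  xget 0 [set m | phibar m = u].

(* (M(X), M(A)), with M(X) = L(A, X) *)
Definition mult_bimod : bimod_data mult_alg :=
  @BimodData R mult_alg (adj_op self_mod rmod)
    (@opnorm R A self_mod rmod)
    (fun T m => adj_comp T m)
    (fun m T => adj_comp (phibar m) T)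
    (fun S T => adj_comp (adj S) T)
    (fun S T => phibar_inv (adj_comp S (adj T))).

End multiplier.

(* Main.v *)
From HB Require Import structures.
Require Import Defs.
From mathcomp Require Import all_boot all_order all_algebra.
From mathcomp Require Import complex ring lra.
From mathcomp Require Import boolp classical_sets reals topology normedtype.

Set Implicit Arguments.
Unset Strict Implicit.
Unset Printing Implicit Defensive.

Import Order.TTheory GRing.Theory Num.Theory numFieldNormedType.Exports Normc.
Local Open Scope classical_set_scope.
Local Open Scope ring_scope.

(** The plan is to verify directly every clause of the definition of an
    essential extension.  No spectral theory is used; the analytic input
    consists of four ingredients.

    - Adjointable maps are automatically linear and bounded (a gliding hump
      argument, [pair_bounded]).  Hence L(E, F) is complete for the operator norm
      and L(E) is a unital C*-algebra ([adj_alg_cstar]); in particular this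
      applies to M(A) = L(A), L(X) and M(X) = L(A, X).

    - The Cauchy--Schwarz inequality for the inner products of X comes from the
      bimodule structure and not from positivity.  Polarization gives
      |<x, y>| <= 4 on the unit ball, and the square of |<x, y>| equals
      |<y, h y>| with h the left inner product of x with itself; a bounded
      sequence r with r_n ^ 2 <= r_(n+1) has r_0 <= 1 ([square_bounded],
      [ip_cs]).

    - Positivity of S* S and T T* in the sense required here means that they
      are of the form b* b.  In a unital C*-algebra the square root of 1 - a,
      for |a| <= 1, is obtained by iterating y |-> (a + y ^ 2) / 2.  It turns
      the squares of self-adjoint elements into a convex cone, described by
      the inequality |1 - h| <= 1 up to scaling, on which the norm is monotone
      ([psqD], [psq_mono]).  The cone contains all b* b ([psq_starM]).
      Applied inside M(A), this shows that the norm of A is monotone on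
      positive elements, so that an operator h on a Hilbert module with
      <x, h x> >= 0 for all x has a square root ([op_pos]).

    - The isomorphism of M(A) onto L(X) extending the left action is built by
      hand.  A multiplier M is sent to the operator that maps x to the only y
      with b y = (b M) x for all b in A ([lift_op]).  Conversely an operator T
      is sent to the multiplier that maps a to the only c with c x = T (a x)
      for all x ([compact_mult]).  The latter exists because fullness makes a
      a limit of sums of left inner products <u_i, v_i>, and
      |sum <T u_i, v_i>| <= |T| |sum <u_i, v_i>| ([lip_sum_norm], by the same
      self-improvement of a bounded sequence).  The first
      construction gives the only extension of the left action, hence
      [phibar], and it is isometric ([phibar_norm]).

    Granting these, the algebraic clauses are short computations.  A is an
    ideal of M(A) because M a = M(a), and an essential one because M <> 0
    forces M a <> 0 for some a.  Invariance holds because both A M(X) and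
    M(X) A span, up to closure, the image of X: indeed T a = T(a) lies in
    X = A X, and <u, v> T = u (T* v)* lies in X A. *)

(** * Banach spaces through controlled sequences *)

Section real_norms.
Variable R : realType.

(** The axioms of a norm for a real-valued function on a complex vector space. *)
Record is_norm (V : lmodType R[i]) (nrm : V -> R) : Prop := IsNorm {
  nmD : forall x y, nrm (x + y) <= nrm x + nrm y;
  nmZ : forall (c : R[i]) x, nrm (c *: x) = normc c * nrm x;
  nm0_eq0 : forall x, nrm x = 0 -> x = 0 }.

(** A bound that takes arbitrarily small values; it need not be monotone, since
    it is only used through inequalities valid for all indices. *)
Definition rate (d : nat -> R) := forall e, 0 < e -> exists n, d n < e.

(** Completeness for sequences with an explicit rate of convergence: the limit
    obeys the bound [d] that the differences obey. *)
Definition rate_complete (V : lmodType R[i]) (nrm : V -> R) : Prop :=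
  forall (u : nat -> V) (d : nat -> R), rate d ->
    (forall m n, (n <= m)%N -> nrm (u m - u n) <= d n) ->
    exists l, forall n, nrm (u n - l) <= d n.

Lemma rate_inv : rate (fun n => n.+1%:R^-1).
Proof.
move=> e e0; exists (Num.truncn e^-1).
rewrite invf_plt ?posrE ?ltr0Sn //.
by rewrite truncnS_gt.
Qed.

Lemma rateM K d : 0 <= K -> rate d -> rate (fun n => K * d n).
Proof.
move=> K0 hd e e0.
have K1 : 0 < K + 1 by rewrite ltr_wpDl.
have [n hn] := hd (e / (K + 1)) (divr_gt0 e0 K1); exists n.
have [d0|d0] := lerP 0 (d n); last first.
  by apply: le_lt_trans e0; rewrite mulr_ge0_le0 // ltW.
move: hn; rewrite ltr_pdivlMr // mulrDr mulr1 mulrC => hn.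
by apply: le_lt_trans hn; rewrite lerDl.
Qed.

Lemma rate_le0 d (x : R) : rate d -> (forall n, x <= d n) -> x <= 0.
Proof.
move=> hd hx; rewrite leNgt; apply/negP => x0.
by have [n] := hd _ x0; rewrite ltNge hx.
Qed.

Lemma normcC (r : R) : normc (r%:C)%C = `|r|.
Proof. by rewrite /normc /= expr0n addr0 sqrtr_sqr. Qed.

Lemma normc_ge0 (c : R[i]) : 0 <= normc c.
Proof. by case: c => a b; exact: sqrtr_ge0. Qed.

Section norm_facts.
Variables (V : lmodType R[i]) (nrm : V -> R).
Hypothesis N : is_norm nrm.
Implicit Types x y : V.

Lemma nm0 : nrm 0 = 0.
Proof. by rewrite -(scale0r (0 : V)) (nmZ N) normc0 mul0r. Qed.

Lemma nmN x : nrm (- x) = nrm x.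
Proof. by rewrite -scaleN1r (nmZ N) normcN normc1 mul1r. Qed.

Lemma nm_ge0 x : 0 <= nrm x.
Proof.
have := nmD N x (- x); rewrite subrr nm0 nmN => h.
by rewrite -(pmulrn_lge0 _ (ltn0Sn 1)) mulr2n.
Qed.

Lemma nmB x y : nrm (x - y) = nrm (y - x).
Proof. by rewrite -nmN opprB. Qed.

Lemma nmT y x z : nrm (x - z) <= nrm (x - y) + nrm (y - z).
Proof. by have := nmD N (x - y) (y - z); rewrite addrA subrK. Qed.

Lemma nm_le0 x : nrm x <= 0 -> x = 0.
Proof. by move=> h; apply: (nm0_eq0 N); apply/eqP; rewrite eq_le h nm_ge0. Qed.

Lemma nm_rate_eq d x y : rate d -> (forall n, nrm (x - y) <= d n) -> x = y.
Proof.
by move=> hd h; apply/eqP; rewrite -subr_eq0; apply/eqP/nm_le0/(rate_le0 hd).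
Qed.

Lemma nmZr (r : R) x : nrm ((r%:C)%C *: x) = `|r| * nrm x.
Proof. by rewrite (nmZ N) normcC. Qed.

Lemma nm_dbl x : nrm (x + x) = 2 * nrm x.
Proof.
rewrite -(ger0_norm (ler0n R 2)) -nmZr rmorphD scalerDl.
by rewrite rmorph1 scale1r.
Qed.

Lemma nm_sum (I : Type) (s : seq I) (P : pred I) (F : I -> V) :
  nrm (\sum_(i <- s | P i) F i) <= \sum_(i <- s | P i) nrm (F i).
Proof.
elim/big_rec2: _ => [|i y1 y2 _ h]; first by rewrite nm0.
by apply: le_trans (nmD N _ _) _; rewrite lerD2l.
Qed.

End norm_facts.

Lemma banach_norm (V : lmodType R[i]) (nrm : V -> R) : is_banach nrm -> is_norm nrm.
Proof.
case=> m [hm _]; have toC x : (nrm x)%:C%C = Lmodule_isNormed.norm m x by rewrite -hm.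
split=> [x y|c x|x x0].
- by rewrite -lecR rmorphD /= !toC; exact: Lmodule_isNormed.ler_normD.
- by apply: (@complexI R); rewrite rmorphM /= !toC; exact: Lmodule_isNormed.normrZ.
- by apply: (@Lmodule_isNormed.normr0_eq0 _ _ _ _ _ _ _ _ _ _ _ _ m); rewrite -toC x0.
Qed.

Lemma banach_complete (V : lmodType R[i]) (nrm : V -> R) :
  is_banach nrm -> rate_complete nrm.
Proof.
move=> B; have N := banach_norm B; case: B => m [hm cm] u d hd hu.
pose W := normed_pack m.
pose v : nat -> W := u.
have nV (x : W) : `|x| = (nrm x)%:C%C := hm x.
have nVB (x y : W) : `|x - y| = (nrm (x - y))%:C%C := hm (x - y).
have cv : cauchy (v @ \oo).
  apply: cauchy_exP => e e0.
  have eR : e = (complex.Re e)%:C%C by rewrite RRe_real // gtr0_real.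
  have [n hn] : exists n, d n < complex.Re e by apply: hd; rewrite -ltcR -eR.
  exists (v n); exists n => // k /= nk.
  rewrite -ball_normE /ball_ /= nVB eR ltcR (nmB N).
  by apply: le_lt_trans hn; exact: hu.
have hl : v @ \oo --> lim (v @ \oo) := cm (v @ \oo) (fmap_proper_filter v eventually_filter) cv.
exists (lim (v @ \oo)) => n.
apply/ler_addgt0Pr => e e0.
have e0' : 0 < (e%:C)%C :> R[i] by rewrite ltcR.
have [k _ hk] := (@cvgrPdist_lt _ _ _ _ _ _ _).1 hl _ e0'.
have := hk (maxn k n) (leq_maxl _ _).
rewrite /= nVB ltcR => hlt.
apply: le_trans (nmT N (u (maxn k n)) _ _) _.
apply: lerD; first by rewrite (nmB N); apply: hu; exact: leq_maxr.
by rewrite (nmB N); exact: ltW.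
Qed.

Lemma norm_banach (V : lmodType R[i]) (nrm : V -> R) :
  is_norm nrm -> rate_complete nrm -> is_banach nrm.
Proof.
move=> N C.
have hD (x y : V) : (nrm (x + y))%:C%C <= (nrm x)%:C%C + (nrm y)%:C%C.
  by rewrite -rmorphD lecR (nmD N).
have hZ (c : R[i]) (x : V) : (nrm (c *: x))%:C%C = `|c| * (nrm x)%:C%C.
  by rewrite (nmZ N) rmorphM.
have h0 (x : V) : (nrm x)%:C%C = 0 -> x = 0.
  by move/(@complexI R) => /(nm0_eq0 N).
pose m := Lmodule_isNormed.Build R[i] V hD hZ h0.
exists m; split=> // F FF cF; have FF0 : Filter F := @filter_filter _ F FF.
pose W := normed_pack m.
have hF n : exists x : W, F (ball x ((n.+1%:R^-1)%:C%C)).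
  have /cauchyP := cF; apply; rewrite ltcR invr_gt0 ltr0Sn //.
pose u n := projT1 (cid (hF n)).
have uF n : F (ball (u n) ((n.+1%:R^-1)%:C%C)) := projT2 (cid (hF n)).
have nVB (x y : W) : `|x - y| = (nrm (x - y))%:C%C by [].
have hu k n : (n <= k)%N -> nrm (u k - u n) <= 2 * n.+1%:R^-1.
  move=> nk; have [z [/= ]] := @filter_ex _ F FF _ (@filterI _ F FF0 _ _ (uF k) (uF n)).
  rewrite -!ball_normE /ball_ /= !nVB !ltcR => h1 h2.
  apply: le_trans (nmT N z _ _) _.
  rewrite mulr_natl mulr2n lerD //; last by rewrite (nmB N) ltW.
  apply: le_trans (ltW h1) _.
  by rewrite lef_pV2 ?posrE ?ltr0Sn // ler_nat.
have rd : rate (fun n => 2 * n.+1%:R^-1) by exact: rateM rate_inv.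
have [l hl] := C _ _ rd hu.
apply/cvg_ex; exists (l : W); apply: (@fcvgrPdist_lt _ W F FF0 _).2 => e e0.
have eR : e = (complex.Re e)%:C%C by rewrite RRe_real // gtr0_real.
have e0' : 0 < complex.Re e by rewrite -ltcR -eR.
have [n hn] : exists n, 3 * n.+1%:R^-1 < complex.Re e by apply: (rateM _ rate_inv).
apply: (@filterS _ F FF0 _ _ _ (uF n)) => x.
rewrite -ball_normE /ball_ /= !nVB eR !ltcR => hx.
apply: le_lt_trans hn; apply: le_trans (nmT N (u n) _ _) _.
have := hl n; rewrite (nmB N) => {}hl.
have -> : (3 : R) * n.+1%:R^-1 = 2 * n.+1%:R^-1 + n.+1%:R^-1 by ring.
by apply: lerD => //; exact: ltW.
Qed.

End real_norms.

(** * Elementary identities in C*-algebras *)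

Section cstar_facts.
Variables (R : realType) (A : cstarAlg R).
Let AP := cstarP A.

Lemma cs_is_norm : is_norm (@cs_norm R A).
Proof. exact: banach_norm (cs_banach AP). Qed.

Lemma cs_mulDl (a b c : A) : cs_mul (a + b) c = cs_mul a c + cs_mul b c.
Proof. by have := cs_mul_linearl AP c 1 a b; rewrite !scale1r. Qed.

Lemma cs_mulDr (a b c : A) : cs_mul c (a + b) = cs_mul c a + cs_mul c b.
Proof. by have := cs_mul_linearr AP c 1 a b; rewrite !scale1r. Qed.

Lemma cs_mul0l (c : A) : cs_mul 0 c = 0.
Proof. by apply: (addrI (cs_mul 0 c)); rewrite -cs_mulDl !addr0. Qed.

Lemma cs_mul0r (c : A) : cs_mul c 0 = 0.
Proof. by apply: (addrI (cs_mul c 0)); rewrite -cs_mulDr !addr0. Qed.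

Lemma cs_mulZl (k : R[i]) (a c : A) : cs_mul (k *: a) c = k *: cs_mul a c.
Proof. by have := cs_mul_linearl AP c k a 0; rewrite !addr0 cs_mul0l addr0. Qed.

Lemma cs_mulZr (k : R[i]) (a c : A) : cs_mul c (k *: a) = k *: cs_mul c a.
Proof. by have := cs_mul_linearr AP c k a 0; rewrite !addr0 cs_mul0r addr0. Qed.

Lemma cs_star0 : cs_star (0 : A) = 0.
Proof. by have := cs_starZ AP 0 0; rewrite !scale0r conjC0 scale0r. Qed.

Lemma cs_starN (a : A) : cs_star (- a) = - cs_star a.
Proof. by apply: (addrI (cs_star a)); rewrite -(cs_starD AP) !subrr cs_star0. Qed.

Lemma cs_mulNr (a b : A) : cs_mul a (- b) = - cs_mul a b.
Proof. by rewrite -scaleN1r cs_mulZr scaleN1r. Qed.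

Lemma cs_norm_starE (a : A) : cs_norm (cs_star a) = cs_norm a.
Proof.
have le (b : A) : cs_norm b <= cs_norm (cs_star b).
  have [->|b0] := eqVneq b 0; first by rewrite cs_star0.
  have bp : 0 < cs_norm b.
    rewrite lt0r (nm_ge0 cs_is_norm) andbT.
    by apply: contra b0 => /eqP/(nm0_eq0 cs_is_norm) ->.
  have := cs_normM AP (cs_star b) b.
  by rewrite (cs_norm_star AP) expr2 ler_pM2r.
by apply/eqP; rewrite eq_le le -{2}(cs_starK AP a) le.
Qed.

Lemma cs_norm_star2 (a : A) : cs_norm (cs_mul a (cs_star a)) = cs_norm a ^+ 2.
Proof. by rewrite -{1}(cs_starK AP a) (cs_norm_star AP) cs_norm_starE. Qed.

Lemma cs_eq0 (a : A) : cs_mul (cs_star a) a = 0 -> a = 0.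
Proof.
move=> h; apply: (nm0_eq0 cs_is_norm); apply/eqP.
by rewrite -sqrf_eq0 -(cs_norm_star AP) h (nm0 cs_is_norm).
Qed.

Lemma cs_eq0r (a : A) : (forall b, cs_mul a b = 0) -> a = 0.
Proof.
move=> h; apply: (nm0_eq0 cs_is_norm); apply/eqP; rewrite -sqrf_eq0 -cs_norm_star2 h.
by rewrite (nm0 cs_is_norm).
Qed.

Lemma cs_eq0l (a : A) : (forall b, cs_mul b a = 0) -> a = 0.
Proof. by move=> h; apply: cs_eq0. Qed.

Lemma cs_star_sum (I : Type) (r : seq I) (f : I -> A) :
  cs_star (\sum_(i <- r) f i) = \sum_(i <- r) cs_star (f i).
Proof. by apply: (big_morph _ (cs_starD AP)); exact: cs_star0. Qed.

Lemma cs_mul_suml (I : Type) (r : seq I) (f : I -> A) (c : A) :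
  cs_mul (\sum_(i <- r) f i) c = \sum_(i <- r) cs_mul (f i) c.
Proof.
apply: (big_morph (fun a => cs_mul a c)); last exact: cs_mul0l.
by move=> a b; exact: cs_mulDl.
Qed.

Lemma cs_mul_sumr (I : Type) (r : seq I) (f : I -> A) (c : A) :
  cs_mul c (\sum_(i <- r) f i) = \sum_(i <- r) cs_mul c (f i).
Proof.
apply: (big_morph (fun a => cs_mul c a)); last exact: cs_mul0r.
by move=> a b; exact: cs_mulDr.
Qed.

End cstar_facts.

(** * Square roots and positive elements in unital C*-algebras *)

Section unital.
Variable R : realType.

(** A C*-algebra with a two-sided unit; the zero algebra is allowed. *)
Record ucstar := UCstar {
  uc_alg :> cstarAlg R;
  uc_one : uc_alg;
  uc_mul1l : left_id uc_one (@cs_mul R uc_alg);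
  uc_mul1r : right_id uc_one (@cs_mul R uc_alg) }.

(** A copy of the carrier that bears the ring structure, so that the ring
    notations are available. *)
Definition ucar (U : ucstar) : Type := cs_car U.
HB.instance Definition _ (U : ucstar) := GRing.Lmodule.copy (ucar U) (cs_car U).

Section instances.
Variable U : ucstar.
HB.instance Definition _ := GRing.Zmodule_isPzRing.Build (ucar U)
  (cs_mulA (cstarP U)) (@uc_mul1l U) (@uc_mul1r U)
  (fun a b c => @cs_mulDl R U a b c) (fun c a b => @cs_mulDr R U a b c).

End instances.

Notation "r ** a" := ((r%:C)%C *: a) (at level 40).

Lemma conjC_realc (r : R) : ((r%:C)%C : R[i])^* = (r%:C)%C.
Proof. exact: conjc_real. Qed.

Section calculus.
Variable U : ucstar.
Notation T := (ucar U).
Implicit Types (a b c x y : T).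

Definition unorm a : R := cs_norm (a : U).
Definition ustar a : T := cs_star (a : U).

Let N : is_norm unorm.
Proof.
have N := cs_is_norm U.
by split; [exact: (nmD N)|exact: (nmZ N)|exact: (nm0_eq0 N)].
Qed.

Lemma unorm_complete : rate_complete unorm.
Proof. exact: (banach_complete (cs_banach (cstarP U))). Qed.

Lemma uZl (k : R[i]) a b : (k *: a) * b = k *: (a * b).
Proof. exact: cs_mulZl. Qed.
Lemma uZr (k : R[i]) a b : a * (k *: b) = k *: (a * b).
Proof. exact: cs_mulZr. Qed.
Lemma unormM a b : unorm (a * b) <= unorm a * unorm b.
Proof. exact: cs_normM (cstarP U) _ _. Qed.
Lemma ustarD a b : ustar (a + b) = ustar a + ustar b.
Proof. exact: cs_starD (cstarP U) _ _. Qed.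
Lemma ustarN a : ustar (- a) = - ustar a.
Proof. exact: cs_starN. Qed.
Lemma ustarZ (k : R[i]) a : ustar (k *: a) = k^* *: ustar a.
Proof. exact: cs_starZ (cstarP U) _ _. Qed.
Lemma ustarZr (r : R) a : ustar (r ** a) = r ** ustar a.
Proof. by rewrite ustarZ conjC_realc. Qed.
Lemma ustarK a : ustar (ustar a) = a.
Proof. exact: cs_starK (cstarP U) _. Qed.
Lemma ustarM a b : ustar (a * b) = ustar b * ustar a.
Proof. exact: cs_starM (cstarP U) _ _. Qed.
Lemma ustar1 : ustar 1 = 1.
Proof. by have := ustarM (ustar 1) 1; rewrite ustarK mulr1 ustarK. Qed.
Lemma unormC a : unorm (ustar a * a) = unorm a ^+ 2.
Proof. exact: cs_norm_star (cstarP U) _. Qed.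
Lemma unorm_star a : unorm (ustar a) = unorm a.
Proof. exact: cs_norm_starE. Qed.
Lemma unormsq k : ustar k = k -> unorm (k * k) = unorm k ^+ 2.
Proof. by move=> hk; rewrite -{1}hk unormC. Qed.
Lemma unorm1 : unorm 1 <= 1.
Proof.
have := unormC 1; rewrite ustar1 mulr1 expr2 => /eqP.
rewrite -subr_eq0 -{1}[unorm 1]mulr1 -mulrBr mulf_eq0 => /orP[/eqP->|] //.
by rewrite subr_eq0 => /eqP <-.
Qed.

(** The scalar iteration t |-> (1 + t ^ 2) / 2 from 0, which increases to 1 and
    dominates the norms of the iterates [yiter]. *)
Fixpoint titer n : R := if n is n'.+1 then 2^-1 * (1 + titer n' * titer n') else 0.

Lemma titer_bnd n : 0 <= titer n <= 1.
Proof. by elim: n => [|n /andP[h0 h1]] /=; [rewrite lexx ler01|nra]. Qed.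

Lemma titer_le n m : (n <= m)%N -> titer n <= titer m.
Proof.
move=> /subnK <-; elim: (m - n)%N => [|k IH] //.
apply: le_trans IH _; rewrite addSn /=.
by have := sqr_ge0 (1 - titer (k + n)); rewrite expr2; lra.
Qed.

Definition tgap n := 1 - titer n.

(** The gap s = 1 - t satisfies s' = s - s ^ 2 / 2, whence s_n <= 2 / (n + 2). *)
Lemma tgap_le n : tgap n <= 2 * n.+1%:R^-1.
Proof.
(* The bound with n + 2 in place of n + 1 is the one that passes to n + 1. *)
suff h k : tgap k * k.+2%:R <= 2.
  have hp : (0 : R) < n.+1%:R by rewrite ltr0Sn.
  rewrite ler_pdivlMr //; apply: le_trans (h n).
  apply: ler_wpM2l; last by rewrite ler_nat.
  by rewrite /tgap subr_ge0; case/andP: (titer_bnd n).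
elim: k => [|k IH]; first by rewrite /tgap /=; lra.
have /andP[h0 h1] := titer_bnd k; move: IH; rewrite /tgap /=.
set t := titer k in h0 h1 *.
have -> : k.+2%:R = k%:R + 2 :> R by rewrite -!natr1; lra.
have -> : k.+3%:R = k%:R + 3 :> R by rewrite -!natr1; lra.
have : 0 <= k%:R :> R by [].
set q := k%:R => q0 IH.
have -> : (1 - 2^-1 * (1 + t * t)) * (q + 3) = (1 - t) * (1 - (1-t)/2) * (q + 3) by field.
set s := 1 - t in IH *; have s0 : 0 <= s by rewrite /s; lra.
have s1 : s <= 1 by rewrite /s; lra.
have e1 : s * (1 - s/2) * (q + 2) = s * (q + 2) - s * (s * (q + 2)) / 2 by field.
set w := s * (q + 2) in IH e1.
have : s * (1 - s/2) <= 2 * (q+1) / (q+2)^+2.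
  rewrite ler_pdivlMr; last by rewrite exprn_gt0 //; lra.
  have -> : s * (1 - s / 2) * (q + 2) ^+ 2 = w * (q + 2) - w * w / 2 by rewrite /w; field.
  nra.
move=> h; apply: le_trans (ler_wpM2r _ h) _; first by lra.
rewrite mulrAC ler_pdivrMr; last by rewrite exprn_gt0 //; lra.
rewrite expr2; nra.
Qed.

Lemma tgap_rate : rate tgap.
Proof.
move=> e e0; have [n hn] := rateM (ler0n R 2) (@rate_inv R) e0.
by exists n; apply: le_lt_trans hn; exact: tgap_le.
Qed.

(** The iteration y |-> (a + y ^ 2) / 2; its limit solves (1 - y) ^ 2 = 1 - a. *)
Fixpoint yiter a n : T := if n is n'.+1 then 2^-1 ** (a + yiter a n' * yiter a n') else 0.

(** Every iterate is a polynomial in its argument, so it inherits any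
    intertwining relation. *)
Lemma yiter_intertw c a a' n : c * a = a' * c -> c * yiter a n = yiter a' n * c.
Proof.
move=> h; elim: n => [|n IH] /=; first by rewrite mulr0 mul0r.
by rewrite uZr uZl mulrDr mulrDl h mulrA IH -!mulrA IH.
Qed.

Lemma yiter_star a n : ustar (yiter a n) = yiter (ustar a) n.
Proof.
elim: n => [|n IH] /=; first exact: cs_star0.
by rewrite ustarZr ustarD ustarM IH.
Qed.

Lemma normh x : unorm (2^-1 ** x) = 2^-1 * unorm x.
Proof. by rewrite (nmZr N) ger0_norm // invr_ge0. Qed.

Lemma halfD x : 2^-1 ** (x + x) = x.
Proof.
rewrite scalerDr -scalerDl -rmorphD /=.
have -> : 2^-1 + 2^-1 = 1 :> R by field.
exact: scale1r.
Qed.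

Section iter.
Variable a : T.
Hypothesis a1 : unorm a <= 1.

Lemma yiter_norm n : unorm (yiter a n) <= titer n.
Proof.
elim: n => [|n IH] /=; first by rewrite (nm0 N).
rewrite normh; apply: ler_wpM2l; first by rewrite invr_ge0.
apply: le_trans (nmD N _ _) _; apply: lerD => //.
apply: le_trans (unormM _ _) _; apply: ler_pM => //; exact: (nm_ge0 N).
Qed.

Lemma yiter_step n : unorm (yiter a n.+1 - yiter a n) <= titer n.+1 - titer n.
Proof.
elim: n => [|n IH].
  rewrite /= !mulr0 !addr0 !subr0 normh mulr1.
  by rewrite ler_piMr // invr_ge0.
have -> : yiter a n.+2 - yiter a n.+1 =
  2^-1 ** ((yiter a n.+1 - yiter a n) * (yiter a n.+1 + yiter a n)).
  have cy : yiter a n * yiter a n.+1 = yiter a n.+1 * yiter a n.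
    by apply: yiter_intertw; rewrite -(@yiter_intertw a a a).
  rewrite {1}[yiter a n.+2]/= {3}[yiter a n.+1]/= -scalerBr; congr (_ *: _).
  rewrite mulrDr !mulrBl [in RHS]cy addrA subrK opprD addrACA subrr add0r.
  by [].
have -> : titer n.+2 - titer n.+1 =
  2^-1 * ((titer n.+1 - titer n) * (titer n.+1 + titer n)).
  have hS k : titer k.+1 = 2^-1 * (1 + titer k * titer k) by [].
  by rewrite (hS n.+1); have := hS n; lra.
rewrite normh; apply: ler_wpM2l; first by rewrite invr_ge0.
apply: le_trans (unormM _ _) _; apply: ler_pM => //; try exact: (nm_ge0 N).
apply: le_trans (nmD N _ _) _; apply: lerD; exact: yiter_norm.
Qed.

Lemma yiter_cauchy m n : (n <= m)%N -> unorm (yiter a m - yiter a n) <= tgap n.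
Proof.
move=> nm; apply: (@le_trans _ _ (titer m - titer n)); last first.
  by rewrite /tgap lerB //; case/andP: (titer_bnd m).
rewrite -(subnK nm); elim: (m - n)%N => [|k IH].
  by rewrite add0n !subrr (nm0 N).
apply: le_trans (nmT N (yiter a (k + n)) _ _) _.
have := yiter_step (k + n); rewrite -addSn => h.
by apply: le_trans (lerD h IH) _; rewrite addrA subrK.
Qed.
End iter.

(** [l] is the limit of the iterates, at the speed of the scalar iteration. *)
Definition is_ylim a l := forall n, unorm (yiter a n - l) <= tgap n.

Lemma usqrt_ex a : {x | unorm a <= 1 -> is_ylim a (1 - x)}.
Proof.
apply: cid; have [a1|a1] := boolP (unorm a <= 1); last by exists 0.
have [l hl] := unorm_complete tgap_rate (yiter_cauchy a1).
by exists (1 - l) => _; rewrite subKr.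
Qed.

(** The square root of [1 - a], meaningful for [unorm a <= 1]. *)
Definition usqrt a : T := sval (usqrt_ex a).

Lemma usqrt_lim a : unorm a <= 1 -> is_ylim a (1 - usqrt a).
Proof. exact: svalP (usqrt_ex a). Qed.

Lemma ylim_uniq a l l' : is_ylim a l -> is_ylim a l' -> l = l'.
Proof.
move=> h h'; apply: (nm_rate_eq N (rateM (ler0n R 2) tgap_rate)) => n.
apply: le_trans (nmT N (yiter a n) _ _) _.
by rewrite mulr_natl mulr2n lerD // (nmB N).
Qed.

Lemma usqrt_norm a : unorm a <= 1 -> unorm (1 - usqrt a) <= 1.
Proof.
by move=> a1; have := usqrt_lim a1 0%N; rewrite /tgap /= sub0r subr0 (nmN N).
Qed.

Lemma usqrt_sq a : unorm a <= 1 -> usqrt a * usqrt a = 1 - a.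
Proof.
move=> a1; have hl := usqrt_lim a1; have y1 := usqrt_norm a1.
set y := 1 - usqrt a in hl y1.
have -> : usqrt a = 1 - y by rewrite /y opprB addrC subrK.
clearbody y.
suff yE : y = 2^-1 ** (a + y * y).
  have h3 : y * y = y + y - a.
    have -> : y + y = a + y * y by rewrite -[RHS]halfD scalerDr -yE.
    by rewrite addrAC subrr add0r.
  rewrite mulrBl mul1r mulrBr mulr1 h3 opprB.
  by rewrite [X in _ + X]addrAC addrK addrA subrK.
apply: (nm_rate_eq N (rateM (ler0n R 2) tgap_rate)) => n.
apply: le_trans (nmT N (yiter a n.+1) _ _) _.
rewrite mulr_natl mulr2n; apply: lerD.
  rewrite (nmB N); apply: le_trans (hl _) _.
  by rewrite /tgap lerB // titer_le.
rewrite /= -scalerBr opprD addrACA subrr add0r normh.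
have -> : yiter a n * yiter a n - y * y = (yiter a n - y) * yiter a n + y * (yiter a n - y).
  by rewrite mulrBl mulrBr addrA subrK.
have t0 : 0 <= tgap n by rewrite /tgap subr_ge0; case/andP: (titer_bnd n).
apply: (@le_trans _ _ (2^-1 * (tgap n + tgap n))); last by lra.
apply: ler_wpM2l; first by rewrite invr_ge0.
apply: le_trans (nmD N _ _) _; apply: lerD; apply: le_trans (unormM _ _) _.
  rewrite -[leRHS]mulr1; apply: ler_pM => //; try exact: (nm_ge0 N).
  by apply: le_trans (yiter_norm a1 n) _; case/andP: (titer_bnd n).
by rewrite -[leRHS]mul1r; apply: ler_pM => //; exact: (nm_ge0 N).
Qed.

Lemma usqrt_star a : unorm a <= 1 -> ustar a = a -> ustar (usqrt a) = usqrt a.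
Proof.
move=> a1 ha; have hl := usqrt_lim a1.
suff h : is_ylim a (1 - ustar (usqrt a)).
  by have := ylim_uniq hl h; move/addrI/oppr_inj.
move=> n; have -> : yiter a n - (1 - ustar (usqrt a)) = ustar (yiter a n - (1 - usqrt a)).
  by rewrite ustarD ustarN ustarD ustarN ustar1 yiter_star ha.
by rewrite unorm_star; exact: (hl n).
Qed.

Lemma usqrt_intertw c a a' : unorm a <= 1 -> unorm a' <= 1 ->
  c * a = a' * c -> c * usqrt a = usqrt a' * c.
Proof.
move=> a1 a1' h; have hl := usqrt_lim a1; have hl' := usqrt_lim a1'.
set y := 1 - usqrt a in hl; set y' := 1 - usqrt a' in hl'.
have -> : usqrt a = 1 - y by rewrite /y opprB addrC subrK.
have -> : usqrt a' = 1 - y' by rewrite /y' opprB addrC subrK.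
clearbody y y'.
rewrite mulrBr mulrBl mulr1 mul1r; congr (_ - _).
have K0 : 0 <= 2 * unorm c by rewrite mulr_ge0 // (nm_ge0 N).
apply: (nm_rate_eq N (rateM K0 tgap_rate)) => n.
apply: le_trans (nmT N (c * yiter a n) _ _) _.
rewrite {2}(yiter_intertw n h) -mulrBr -mulrBl mulrAC mulr_natl mulr2n [leRHS]mulrDl.
have c0 := nm_ge0 N c.
apply: lerD; apply: le_trans (unormM _ _) _; last exact: ler_wpM2r.
by rewrite mulrC; apply: ler_wpM2r => //; rewrite (nmB N).
Qed.

(** The positive elements: squares of self-adjoint elements. *)
Definition psq h := exists k, ustar k = k /\ h = k * k.

Lemma psq_star h : psq h -> ustar h = h.
Proof. by case=> k [hk ->]; rewrite ustarM hk. Qed.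

(** Commuting self-adjoint k and l with k ^ 2 + l ^ 2 = 1 are the real and
    imaginary parts of a unitary. *)
Lemma psq_unitary k l : ustar k = k -> ustar l = l -> k * l = l * k ->
  k * k + l * l = 1 -> unorm k <= 1.
Proof.
move=> hk hl kl kl1; pose u := k + 'i *: l.
have us : ustar u = k - 'i *: l.
  by rewrite ustarD hk ustarZ hl conjCi scaleNr.
have u1 : unorm u <= 1.
  have : unorm (ustar u * u) <= 1.
    rewrite us /u mulrBl mulrDr uZl mulrDr !uZr scalerDr scalerA.
    have -> : 'i * 'i = -1 :> R[i] by rewrite -expr2 sqrCi.
    by rewrite scaleN1r kl opprD opprK addrA addrK kl1 unorm1.
  by rewrite unormC expr_le1 // (nm_ge0 N).
have kE : k = 2^-1 ** (u + ustar u).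
  by rewrite us addrACA addrN addr0 halfD.
rewrite kE normh; have := nmD N u (ustar u); rewrite unorm_star; lra.
Qed.

Lemma usqrt_comm c a : unorm a <= 1 -> c * a = a * c -> c * usqrt a = usqrt a * c.
Proof. by move=> a1; apply: usqrt_intertw. Qed.

Lemma sq_near k : ustar k = k -> unorm k <= 1 -> unorm (1 - k * k) <= 1.
Proof.
move=> hk k1.
have kk1 : unorm (k * k) <= 1 by rewrite unormsq // expr_le1 // (nm_ge0 N).
have hl : ustar (usqrt (k * k)) = usqrt (k * k).
  by apply: usqrt_star; rewrite // ustarM hk.
have l1 : unorm (usqrt (k * k)) <= 1.
  apply: (@psq_unitary _ k) => //; last by rewrite usqrt_sq // subrK.
  by rewrite usqrt_comm // mulrA.
by rewrite -usqrt_sq // unormsq // expr_le1 // (nm_ge0 N).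
Qed.

Lemma psq_near h : psq h -> unorm h <= 1 -> unorm (1 - h) <= 1.
Proof.
case=> k [hk ->]; rewrite unormsq // => k1; apply: sq_near => //.
by rewrite -(@expr_le1 _ 2) // (nm_ge0 N).
Qed.

(** Self-adjoint elements at distance at most 1 from 1 have a square root that
    commutes with everything they commute with. *)
Lemma near_sqrt h : ustar h = h -> unorm (1 - h) <= 1 ->
  exists k, [/\ ustar k = k, h = k * k & forall c, c * h = h * c -> c * k = k * c].
Proof.
move=> hh h1; exists (usqrt (1 - h)); split.
- by apply: usqrt_star; rewrite // ustarD ustar1 ustarN hh.
- by rewrite usqrt_sq // opprB addrC subrK.
by move=> c ch; apply: usqrt_comm; rewrite // mulrBl mulrBr mul1r mulr1 ch.
Qed.

Lemma near_psq h : ustar h = h -> unorm (1 - h) <= 1 -> psq h.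
Proof. by move=> hh /(near_sqrt hh)[k [? ? _]]; exists k. Qed.

Lemma sqrtZ (r : R) (k : T) : 0 <= r -> (Num.sqrt r ** k) * (Num.sqrt r ** k) = r ** (k * k).
Proof.
by move=> r0; rewrite uZl uZr scalerA -rmorphM /= -expr2 sqr_sqrtr.
Qed.

Lemma psqZ (r : R) (h : T) : 0 <= r -> psq h -> psq (r ** h).
Proof.
move=> r0 [k [hk ->]]; exists (Num.sqrt r ** k).
by rewrite ustarZr hk sqrtZ.
Qed.

Lemma rsK (r : R) (h : T) : r != 0 -> r ** (r^-1 ** h) = h.
Proof. by move=> r0; rewrite scalerA -rmorphM /= mulfV // scale1r. Qed.

Lemma psqP h : psq h ->
  exists k, [/\ ustar k = k, h = k * k & forall c, c * h = h * c -> c * k = k * c].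
Proof.
move=> ph; pose s := 1 + unorm h; have h0 := nm_ge0 N h.
have s0 : 0 < s by rewrite /s; lra.
have ph' : psq (s^-1 ** h) by apply: psqZ; rewrite // invr_ge0 ltW.
have h1 : unorm (s^-1 ** h) <= 1.
  rewrite (nmZr N) ger0_norm ?invr_ge0 ?(ltW s0) // mulrC ler_pdivrMr // /s; lra.
have [k [hk hE ck]] := near_sqrt (psq_star ph') (psq_near ph' h1).
exists (Num.sqrt s ** k); split.
- by rewrite ustarZr hk.
- by rewrite sqrtZ ?(ltW s0) // -hE rsK // gt_eqF.
move=> c ch; rewrite uZl uZr ck // uZl uZr ch //.
Qed.

Lemma psqD g h : psq g -> psq h -> psq (g + h).
Proof.
(* After scaling by s both summands are near 1, hence so is their mean. *)
move=> pg ph; pose s := 1 + unorm g + unorm h.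
have g0 := nm_ge0 N g; have h0 := nm_ge0 N h.
have s0 : 0 < s by rewrite /s; lra.
have si : 0 <= s^-1 by rewrite invr_ge0 ltW.
have n1 x : psq x -> unorm x <= s -> unorm (1 - s^-1 ** x) <= 1.
  move=> px xs; apply: psq_near; first exact: psqZ.
  by rewrite (nmZr N) ger0_norm // mulrC ler_pdivrMr // mul1r.
have g1 := n1 _ pg; have h1 := n1 _ ph.
have -> : g + h = (2 * s) ** (2^-1 ** (s^-1 ** g + s^-1 ** h)).
  rewrite scalerA -rmorphM /= mulrAC mulfV ?pnatr_eq0 // mul1r scalerDr.
  by rewrite !rsK // gt_eqF.
apply: psqZ; first by rewrite mulr_ge0 // ltW.
apply: near_psq.
  by rewrite ustarZr ustarD !ustarZr !psq_star.
have -> : 1 - 2^-1 ** (s^-1 ** g + s^-1 ** h) =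
    2^-1 ** ((1 - s^-1 ** g) + (1 - s^-1 ** h)).
  rewrite addrACA -opprD scalerBr; congr (_ - _).
  by rewrite halfD.
rewrite normh; apply: (@le_trans _ _ (2^-1 * (1 + 1))); last by lra.
apply: ler_wpM2l; first by rewrite invr_ge0.
apply: le_trans (nmD N _ _) _; apply: lerD; [apply: g1|apply: h1]; rewrite /s; lra.
Qed.

Lemma psq_le1 p : psq p -> psq (1 - p) -> unorm p <= 1.
Proof.
move=> /psqP[k [hk pE ck]] /psqP[l [hl lE cl]].
rewrite pE unormsq // expr_le1 // ?(nm_ge0 N) //.
apply: (psq_unitary hk hl); last by rewrite -pE -lE addrC subrK.
by apply: cl; rewrite mulrBl mulrBr mulr1 mul1r pE mulrA.
Qed.

Lemma psq_mono p q : psq p -> psq q -> unorm p <= unorm (p + q).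
Proof.
move=> pp pq; apply/ler_addgt0Pr => e e0; set t := unorm (p + q).
have t0 : 0 <= t by exact: nm_ge0.
have s0 : 0 < t + e by rewrite ltr_wpDl.
have si : 0 <= (t + e)^-1 by rewrite invr_ge0 ltW.
have nZ x : unorm ((t + e)^-1 ** x) = unorm x / (t + e).
  by rewrite (nmZr N) ger0_norm // mulrC.
suff : unorm ((t + e)^-1 ** p) <= 1 by rewrite nZ ler_pdivrMr // mul1r.
apply: psq_le1; first exact: psqZ.
have -> : 1 - (t + e)^-1 ** p = (1 - (t + e)^-1 ** (p + q)) + (t + e)^-1 ** q.
  by rewrite scalerDr opprD addrA subrK.
apply: psqD; last exact: psqZ.
apply: near_psq.
  by rewrite ustarD ustarN ustar1 ustarZr ustarD !psq_star.
by rewrite subKr nZ ler_pdivrMr // mul1r lerDl ltW.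
Qed.

Lemma psq_anti p q : psq p -> psq q -> p + q = 0 -> p = 0.
Proof.
by move=> pp pq pq0; apply: (nm_le0 N); have := psq_mono pp pq; rewrite pq0 (nm0 N).
Qed.

Lemma psq_conj p d : psq p -> ustar d = d -> d * p = p * d -> psq (d * p * d).
Proof.
move=> /psqP[k [hk -> ck]] hd /ck dk; exists (d * k).
by rewrite ustarM hk hd; split=> //; rewrite -!mulrA dk.
Qed.

Lemma ustar_eq0 a : ustar a * a = 0 -> a = 0.
Proof. exact: cs_eq0. Qed.

Lemma sa_eq0 d : ustar d = d -> d * d = 0 -> d = 0.
Proof. by move=> hd dd; apply: ustar_eq0; rewrite hd. Qed.

(** Uniqueness of positive square roots, among commuting elements. *)
Lemma psq_inj p q : psq p -> psq q -> p * q = q * p -> p * p = q * q -> p = q.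
Proof.
move=> pp pq pq_comm sq; pose d := p - q.
have hd : ustar d = d by rewrite ustarD ustarN !psq_star.
have dp : d * p = p * d by rewrite mulrBl mulrBr pq_comm.
have dq : d * q = q * d by rewrite mulrBl mulrBr pq_comm.
have d1 := psq_conj pp hd dp; have d2 := psq_conj pq hd dq.
have s0 : d * p * d + d * q * d = 0.
  rewrite -mulrDl -mulrDr; suff -> : d * (p + q) = 0 by rewrite mul0r.
  by rewrite mulrBl !mulrDr sq pq_comm [X in X - _]addrC subrr.
have z1 := psq_anti d1 d2 s0; move: s0; rewrite z1 add0r => z2.
have d3 : d * d * d = 0.
  have -> : d * d * d = d * p * d - d * q * d by rewrite -mulrBl -mulrBr.
  by rewrite z1 z2 subrr.
have dd : d * d = 0.
  by apply: sa_eq0; rewrite ?ustarM ?hd // mulrA d3 mul0r.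
by apply/eqP; rewrite -subr_eq0; apply/eqP/(sa_eq0 hd).
Qed.

Lemma unormsq_le1 k : unorm k <= 1 -> unorm (k * k) <= 1.
Proof.
move=> k1; apply: le_trans (unormM _ _) _; rewrite -[leRHS]mulr1.
by apply: ler_pM => //; exact: nm_ge0.
Qed.

Lemma psq_usqrt a : ustar a = a -> unorm a <= 1 -> psq (usqrt a).
Proof.
move=> ha a1; apply: near_psq; first exact: usqrt_star.
exact: usqrt_norm.
Qed.

Lemma sa_1sq h : ustar h = h -> ustar (1 - h * h) = 1 - h * h.
Proof. by move=> hh; rewrite ustarD ustarN ustarM ustar1 hh. Qed.

Lemma usqrt_sqK q : psq q -> unorm q <= 1 -> usqrt (1 - q * q) = q.
Proof.
move=> pq q1; have hq := psq_star pq; have n1 := sq_near hq q1.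
apply: psq_inj => //; first by apply: psq_usqrt => //; exact: sa_1sq.
  by symmetry; apply: usqrt_comm; rewrite // mulrBl mulrBr mul1r mulr1 mulrA.
by rewrite usqrt_sq // subKr.
Qed.

(** If c* c is negative and c c* positive, then c vanishes: intertwining the
    square roots of the squares gives c |c* c| = |c c*| c, so that both sides
    equal their own opposite. *)
Lemma psq_star_opp c q : unorm c <= 1 -> psq q -> ustar c * c = - q ->
  psq (c * ustar c) -> c = 0.
Proof.
move=> c1 pq cq pr; set r := c * ustar c in pr.
have q1 : unorm q <= 1 by rewrite -(nmN N) -cq unormC expr_le1 // (nm_ge0 N).
have r1 : unorm r <= 1.
  by rewrite /r -{1}[c]ustarK unormC unorm_star expr_le1 // (nm_ge0 N).
(* As q = |c* c| and r = |c c*|, intertwining gives c q = r c as well. *)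
have cqr : c * q = - (r * c) by rewrite -[q]opprK -cq mulrN mulrA.
have hc : c * (1 - q * q) = (1 - r * r) * c.
  by rewrite mulrBr mulrBl mulr1 mul1r mulrA cqr mulNr -mulrA cqr mulrN opprK mulrA.
have := usqrt_intertw (sq_near (psq_star pq) q1) (sq_near (psq_star pr) r1) hc.
rewrite (usqrt_sqK pq q1) (usqrt_sqK pr r1) => e.
have cq0 : c * q = 0.
  by rewrite -[c * q]halfD {2}cqr e subrr scaler0.
have q0 : q = 0.
  apply: sa_eq0; first exact: psq_star.
  by rewrite -{1}[q]opprK -cq mulNr -mulrA cq0 mulr0 oppr0.
by apply: ustar_eq0; rewrite cq q0 oppr0.
Qed.

Lemma sq_polar a b : (a + b) * (a + b) - (a - b) * (a - b) =
  (a * b + b * a) + (a * b + b * a).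
Proof.
rewrite mulrDr mulrBr opprB [_ - (a - b) * a]addrC addrACA -mulrBl -mulrDl.
have -> : a + b - (a - b) = b + b by rewrite opprB addrC addrA subrK.
have -> : a + b + (a - b) = a + a by rewrite addrACA subrr addr0.
by rewrite !mulrDl addrC [RHS]addrACA.
Qed.

(** With c = x + i z for self-adjoint x and z, the sum of c c* and c* c is
    2 (x ^ 2 + z ^ 2). *)
Lemma psq_star_sum c : psq (c * ustar c + ustar c * c).
Proof.
pose x := c + ustar c; pose z := 'i *: (c - ustar c).
have hx : ustar x = x by rewrite ustarD ustarK addrC.
have hz : ustar z = z.
  by rewrite ustarZ ustarD ustarN ustarK conjCi scaleNr -scalerN opprB.
have -> : c * ustar c + ustar c * c = 2^-1 ** (x * x + z * z).
  rewrite uZl uZr scalerA.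
  have -> : 'i * 'i = -1 :> R[i] by rewrite -expr2 sqrCi.
  by rewrite scaleN1r /x sq_polar halfD.
apply: psqZ; first by rewrite invr_ge0.
by apply: psqD; [exists x|exists z].
Qed.

(** Let h = b* b, y = |h| and let p = (y - h) / 2 be the negative part of h.
    Then c = b p has c* c = - p y p, which is negative, and c c* positive, so
    c = 0; this forces p = 0 and h = |h|. *)
Lemma psq_starM1 b : unorm b <= 1 -> psq (ustar b * b).
Proof.
move=> b1; set h := ustar b * b.
have hh : ustar h = h by rewrite ustarM ustarK.
have h1 : unorm h <= 1 by rewrite unormC expr_le1 // (nm_ge0 N).
have n1 := sq_near hh h1; pose y := usqrt (1 - h * h).
have py : psq y by apply: psq_usqrt => //; exact: sa_1sq.
have hy := psq_star py.
have yy : y * y = h * h by rewrite /y usqrt_sq // subKr.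
have yh : h * y = y * h.
  by apply: usqrt_comm; rewrite // mulrBl mulrBr mul1r mulr1 mulrA.
have y1 : unorm y <= 1.
  by rewrite -(@expr_le1 _ 2) ?(nm_ge0 N) // -unormsq // yy unormsq_le1.
clearbody y.
pose p := 2^-1 ** (y - h).
have hp : ustar p = p by rewrite ustarZr ustarD ustarN hh hy.
have p1 : unorm p <= 1.
  rewrite normh; have := nmD N y (- h); rewrite (nmN N); lra.
have py_comm : p * y = y * p by rewrite uZl uZr mulrBl mulrBr yh.
have hpE : h * p = - (y * p).
  by rewrite !uZr -scalerN !mulrBr opprB yy yh.
have cc : ustar (b * p) * (b * p) = - (p * y * p).
  by rewrite ustarM hp -mulrA [ustar b * _]mulrA -/h hpE mulrN mulrA.
have c0 : b * p = 0.
  apply: (psq_star_opp _ (psq_conj py hp py_comm) cc).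
    apply: le_trans (unormM _ _) _; rewrite -[leRHS]mulr1.
    by apply: ler_pM => //; exact: nm_ge0.
  have -> : b * p * ustar (b * p) =
    (b * p * ustar (b * p) + ustar (b * p) * (b * p)) + p * y * p.
    by rewrite cc subrK.
  by apply: psqD; [exact: psq_star_sum|exact: psq_conj].
have hp0 : h * p = 0 by rewrite -mulrA c0 mulr0.
have yp0 : y * p = 0 by apply/eqP; rewrite -oppr_eq0 -hpE hp0.
have p0 : p = 0.
  by apply: sa_eq0 => //; rewrite {1}/p uZl mulrBl hp0 yp0 subrr scaler0.
suff -> : h = y by [].
apply/eqP; rewrite eq_sym -subr_eq0.
by rewrite -[y - h](@rsK 2^-1^-1) ?invrK ?pnatr_eq0 // -/p p0 scaler0.
Qed.

Lemma psq_starM b : psq (ustar b * b).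
Proof.
pose s := 1 + unorm b; have b0 := nm_ge0 N b.
have s0 : 0 < s by rewrite /s; lra.
have -> : ustar b * b = (s * s) ** (ustar (s^-1 ** b) * (s^-1 ** b)).
  by rewrite ustarZr uZl uZr rmorphM /= -scalerA !rsK // gt_eqF.
apply: psqZ; first by rewrite mulr_ge0 // ltW.
apply: psq_starM1; rewrite (nmZr N) ger0_norm ?invr_ge0 ?(ltW s0) // mulrC.
by rewrite ler_pdivrMr // mul1r /s; lra.
Qed.

End calculus.
End unital.

(** * Adjointable operators between Hilbert modules *)

Section hilbert.
Variables (R : realType) (A : cstarAlg R).
Implicit Types E F G : ipmod A.

Let AP := cstarP A.
Let NA : is_norm (@cs_norm R A) := cs_is_norm A.

Section ip_facts.
Variable E : ipmod A.
Implicit Types x y z : E.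
Let st := ipr_star (ipmP E).

Lemma ipDr x y z : ipm_ip x (y + z) = ipm_ip x y + ipm_ip x z.
Proof. by have := ipr_linear (ipmP E) x 1 y z; rewrite !scale1r. Qed.

Lemma ip0r x : ipm_ip x 0 = 0.
Proof. by apply: (addrI (ipm_ip x 0)); rewrite -ipDr !addr0. Qed.

Lemma ipZr x (c : R[i]) y : ipm_ip x (c *: y) = c *: ipm_ip x y.
Proof. by have := ipr_linear (ipmP E) x c y 0; rewrite !addr0 ip0r addr0. Qed.

Lemma ipNr x y : ipm_ip x (- y) = - ipm_ip x y.
Proof. by rewrite -scaleN1r ipZr scaleN1r. Qed.

Lemma ipBr x y z : ipm_ip x (y - z) = ipm_ip x y - ipm_ip x z.
Proof. by rewrite ipDr ipNr. Qed.

Lemma ipDl x y z : ipm_ip (x + y) z = ipm_ip x z + ipm_ip y z.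
Proof. by rewrite st ipDr (cs_starD AP) -!st. Qed.

Lemma ipZl x (c : R[i]) y : ipm_ip (c *: x) y = c^* *: ipm_ip x y.
Proof. by rewrite st ipZr (cs_starZ AP) -st. Qed.

Lemma ipNl x y : ipm_ip (- x) y = - ipm_ip x y.
Proof. by rewrite st ipNr cs_starN -st. Qed.

Lemma ipBl x y z : ipm_ip (x - y) z = ipm_ip x z - ipm_ip y z.
Proof. by rewrite ipDl ipNl. Qed.

End ip_facts.

(** Right Hilbert modules, with the Cauchy--Schwarz inequality as an axiom and
    without the action and the positivity of the inner product. *)
Record hmod E : Prop := Hmod {
  hm_banach : is_banach (@ipm_norm _ _ E);
  hm_sq : forall x : E, ipm_norm x ^+ 2 = cs_norm (ipm_ip x x);
  hm_cs : forall x y : E, cs_norm (ipm_ip x y) <= ipm_norm x * ipm_norm y }.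

Lemma hm_norm E : hmod E -> is_norm (@ipm_norm _ _ E).
Proof. by move=> h; exact: banach_norm (hm_banach h). Qed.

Lemma ip_inj E (x x' : E) : hmod E ->
  (forall y, ipm_ip x y = ipm_ip x' y) -> x = x'.
Proof.
move=> hE h; apply/eqP; rewrite -subr_eq0; apply/eqP/(nm0_eq0 (hm_norm hE))/eqP.
by rewrite -sqrf_eq0 (hm_sq hE) ipBl h subrr (nm0 NA).
Qed.

Lemma exp3_rate : rate (fun n => 3 / 2 * (3 ^+ n)^-1 : R).
Proof.
apply: rateM; first by rewrite divr_ge0.
move=> e e0; have [n hn] := rate_inv e0; exists n.
apply: le_lt_trans hn; rewrite lef_pV2 ?posrE ?ltr0Sn ?exprn_gt0 //.
by rewrite -natrX ler_nat ltn_expl.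
Qed.

Section pair.
Variables (E F : ipmod A) (hE : hmod E) (hF : hmod F).
Let NE := hm_norm hE.
Let NF := hm_norm hF.

Lemma pair_linear (T : E -> F) S (c : R[i]) x y : adjoint_pair T S ->
  T (c *: x + y) = c *: T x + T y.
Proof.
move=> h; apply: (ip_inj hF) => z.
by rewrite h ipDl ipZl ipDl ipZl !h.
Qed.

Lemma pair0 (T : E -> F) S : adjoint_pair T S -> T 0 = 0.
Proof.
by move=> h; have := pair_linear (-1) 0 0 h; rewrite scaler0 addr0 scaleN1r addNr.
Qed.

Lemma pairZ (T : E -> F) S (c : R[i]) x : adjoint_pair T S -> T (c *: x) = c *: T x.
Proof. by move=> h; have := pair_linear c x 0 h; rewrite (pair0 h) !addr0. Qed.

Lemma pairB (T : E -> F) S x y : adjoint_pair T S -> T (x - y) = T x - T y.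
Proof.
by move=> h; have := pair_linear (-1) y x h; rewrite !scaleN1r addrC => ->; rewrite addrC.
Qed.

Lemma pair_uniq (T : E -> F) S S' : adjoint_pair T S -> adjoint_pair T S' -> S =1 S'.
Proof.
by move=> /adjoint_pair_sym h /adjoint_pair_sym h' y; apply: (ip_inj hE) => x; rewrite h h'.
Qed.

(** An adjointable map is bounded.  Otherwise there are x_n in the unit ball
    with T x_n very large; a series of multiples of the T x_n with signs chosen
    one after the other yields an l such that <T x_n, l> = <x_n, S l> is
    unbounded, against the Cauchy--Schwarz inequality. *)
Lemma pair_bounded (T : E -> F) S : adjoint_pair T S ->
  exists2 K, 0 <= K & forall x, ipm_norm (T x) <= K * ipm_norm x.
Proof.
move=> h; apply: contrapT => unb.
have c0 n : 0 <= 2 * n%:R * 3 ^+ n :> R.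
  by rewrite mulr_ge0 ?exprn_ge0 // mulr_ge0.
have big n : exists x : E, ipm_norm x <= 1 /\ 2 * n%:R * 3 ^+ n < ipm_norm (T x).
  apply: contrapT => hn; apply: unb; exists (2 * n%:R * 3 ^+ n) => //.
  move=> x; rewrite leNgt; apply/negP => hx; apply: hn.
  have [x0|x0] := eqVneq (ipm_norm x) 0.
    move: hx; have -> : x = 0 by exact: nm0_eq0 x0.
    by rewrite (pair0 h) !(nm0 NE) (nm0 NF) mulr0 ltxx.
  have xp : 0 < ipm_norm x by rewrite lt0r x0 (nm_ge0 NE).
  exists (((ipm_norm x)^-1%:C)%C *: x).
  have -> : T (((ipm_norm x)^-1%:C)%C *: x) = ((ipm_norm x)^-1%:C)%C *: T x by exact: pairZ h.
  have i0 : 0 <= (ipm_norm x)^-1 by rewrite invr_ge0 ltW.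
  rewrite (nmZr NE) (nmZr NF) (ger0_norm i0) mulVf //; split=> //.
  by rewrite [ltRHS]mulrC ltr_pdivlMr.
pose x n := projT1 (cid (big n)).
have x1 n : ipm_norm (x n) <= 1 by case: (projT2 (cid (big n))).
pose v n := T (x n).
have vb n : 2 * n%:R * 3 ^+ n < ipm_norm (v n) by case: (projT2 (cid (big n))).
have v0 n : 0 < ipm_norm (v n).
  exact: le_lt_trans (vb n).
(* The steps w n have norm 3 ^ - n, so those after the n-th add up to half of it. *)
pose r n : R := (3 ^+ n)^-1.
have r0 n : 0 < r n by rewrite invr_gt0 exprn_gt0.
have q0 n : 0 <= r n / ipm_norm (v n) by rewrite divr_ge0 ?ltW.
pose w n := ((r n / ipm_norm (v n))%:C)%C *: v n.
have wn n : ipm_norm (w n) = r n.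
  by rewrite (nmZr NF) (ger0_norm (q0 n)) divfK ?gt_eqF.
have vw n : cs_norm (ipm_ip (v n) (w n)) = r n * ipm_norm (v n).
  rewrite ipZr (nmZr NA) -(hm_sq hF) (ger0_norm (q0 n)) expr2 mulrA.
  by rewrite divfK ?gt_eqF.
pose step n y := if r n * ipm_norm (v n) <= cs_norm (ipm_ip (v n) (y + w n))
                 then y + w n else y - w n.
pose y := fix y n := if n is n'.+1 then step n' (y n') else 0.
have yS n : y n.+1 = step n (y n) by [].
have y1 n : ipm_norm (y n.+1 - y n) = r n.
  rewrite yS /step; case: ifP => _; first by rewrite addrAC subrr add0r.
  by rewrite addrAC subrr add0r (nmN NF).
(* One of the two signs works, since v n pairs with 2 w n to norm 2 r n |v n|. *)
have y2 n : r n * ipm_norm (v n) <= cs_norm (ipm_ip (v n) (y n.+1)).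
  rewrite yS /step; case: ifPn => //; rewrite -ltNge => hlt.
  rewrite leNgt; apply/negP => hlt2.
  set a := ipm_ip (v n) (y n); set b := ipm_ip (v n) (w n).
  have := nmD NA (a + b) (- (a - b)).
  have -> : a + b - (a - b) = b + b by rewrite opprB addrC addrA subrK.
  rewrite (nm_dbl NA) (nmN NA) leNgt => /negP; apply.
  by rewrite vw; move: hlt hlt2; rewrite ipDr ipBr -/a -/b; lra.
have ym m n : (n <= m)%N -> ipm_norm (y m - y n) <= 3 / 2 * r n.
  move=> nm; apply: (@le_trans _ _ (3 / 2 * (r n - r m))); last first.
    by rewrite ler_wpM2l ?divr_ge0 // gerBl ltW.
  rewrite -(subnK nm); elim: (m - n)%N => [|k IH].
    by rewrite add0n !subrr (nm0 NF) mulr0.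
  apply: le_trans (nmT NF (y (k + n)%N) _ _) _.
  have rS : r (k + n)%N = 3 * r (k + n).+1.
    by rewrite /r exprS invfM mulrA mulfV ?mul1r // pnatr_eq0.
  rewrite addSn y1; move: IH; rewrite rS; lra.
have [l hl] := banach_complete (hm_banach hF) exp3_rate ym.
have hS n : n%:R <= ipm_norm (S l).
  have h1 : cs_norm (ipm_ip (v n) l) <= ipm_norm (S l).
    rewrite /v h; apply: le_trans (hm_cs hE _ _) _.
    by rewrite ler_piMl // nm_ge0.
  apply: le_trans h1.
  have h2 := nmT NA (ipm_ip (v n) l) (ipm_ip (v n) (y n.+1)) 0.
  rewrite !subr0 -ipBr in h2.
  have h3 : cs_norm (ipm_ip (v n) (y n.+1 - l)) <= ipm_norm (v n) * (3 / 2 * r n.+1).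
    by apply: le_trans (hm_cs hF _ _) _; apply: ler_wpM2l; [exact: ltW|exact: hl].
  have rS : r n = 3 * r n.+1.
    by rewrite /r exprS invfM mulrA mulfV ?mul1r // pnatr_eq0.
  have h4 : 2 * n%:R <= r n * ipm_norm (v n).
    by rewrite /r [leRHS]mulrC ler_pdivlMr ?exprn_gt0 // ltW.
  have := y2 n; move: h2 h3 h4; rewrite rS; set t := r n.+1; set q := ipm_norm (v n).
  lra.
have := hS (Num.truncn (ipm_norm (S l))).+1.
by rewrite leNgt truncnS_gt.
Qed.

Implicit Types T S : adj_op E F.

Lemma adjP T : adjoint_pair T (adj T).
Proof. exact: (projT2 (cid (adj_opP T))). Qed.

Lemma adj_uniq T (S : F -> E) : adjoint_pair T S -> forall y, adj T y = S y.
Proof. exact: pair_uniq (adjP T). Qed.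

Lemma adj_ext T S : (forall x, T x = S x) -> T = S.
Proof. by move=> h; apply: val_inj; apply/funext. Qed.

Lemma opnorm_has_sup T :
  has_sup [set ipm_norm (T x) | x in [set x : E | ipm_norm x <= 1]].
Proof.
split; first by exists (ipm_norm (T 0)), 0 => //=; rewrite (nm0 NE).
have [K K0 hK] := pair_bounded (adjP T); exists K => _ [x /= x1 <-].
by apply: le_trans (hK x) _; rewrite ler_piMr.
Qed.

Lemma opnorm_ge0 T : 0 <= opnorm T.
Proof.
apply: le_trans (nm_ge0 NF (T 0)) _; apply: ub_le_sup; last first.
  by exists 0 => //=; rewrite (nm0 NE).
by have [] := opnorm_has_sup T.
Qed.

Lemma opnorm_le T x : ipm_norm (T x) <= opnorm T * ipm_norm x.
Proof.
have [x0|x0] := eqVneq (ipm_norm x) 0.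
  by rewrite (nm0_eq0 NE x0) (pair0 (adjP T)) (nm0 NE) (nm0 NF) mulr0.
have xp : 0 < ipm_norm x by rewrite lt0r x0 (nm_ge0 NE).
have i0 : 0 <= (ipm_norm x)^-1 by rewrite invr_ge0 ltW.
rewrite -ler_pdivrMr // mulrC -{1}(ger0_norm i0) -(nmZr NF) -(pairZ _ _ (adjP T)).
apply: ub_le_sup; first by have [] := opnorm_has_sup T.
by exists (((ipm_norm x)^-1%:C)%C *: x) => //=; rewrite (nmZr NE) (ger0_norm i0) mulVf.
Qed.

Lemma opnorm_lub T K : 0 <= K -> (forall x, ipm_norm (T x) <= K * ipm_norm x) ->
  opnorm T <= K.
Proof.
move=> K0 hK; apply: ge_sup; first by have [] := opnorm_has_sup T.
by move=> _ [x /= x1 <-]; apply: le_trans (hK x) _; rewrite ler_piMr.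
Qed.

(** |T* y| ^ 2 = |<T T* y, y>| bounds the adjoint by the norm of [T]. *)
Lemma adj_le T y : ipm_norm (adj T y) <= opnorm T * ipm_norm y.
Proof.
have [e|e] := eqVneq (ipm_norm (adj T y)) 0.
  by rewrite e mulr_ge0 ?opnorm_ge0 ?(nm_ge0 NF).
have p : 0 < ipm_norm (adj T y) by rewrite lt0r e (nm_ge0 NE).
rewrite -(ler_pM2l p) -expr2 (hm_sq hE) -(adjP T).
apply: le_trans (hm_cs hF _ _) _; rewrite mulrCA mulrA.
by apply: ler_wpM2r; [exact: nm_ge0|exact: opnorm_le].
Qed.

Lemma opnorm_is_norm : is_norm (fun T => opnorm T).
Proof.
split=> [T S|c T|T T0].
- apply: opnorm_lub; first by rewrite addr_ge0 ?opnorm_ge0.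
  move=> x; apply: le_trans (nmD NF (T x) (S x)) _.
  by rewrite mulrDl lerD ?opnorm_le.
- have le (k : R[i]) (U : adj_op E F) : opnorm (k *: U) <= normc k * opnorm U.
    have k0 := normc_ge0 k.
    apply: opnorm_lub; first by rewrite mulr_ge0 ?opnorm_ge0.
    move=> x; rewrite -[ipm_norm _]/(ipm_norm (k *: U x)) (nmZ NF) -mulrA.
    by apply: ler_wpM2l => //; exact: opnorm_le.
  apply/eqP; rewrite eq_le le andTb.
  have [->|c1] := eqVneq c 0; first by rewrite normc0 mul0r; exact: opnorm_ge0.
  have n0 : normc c != 0 by apply: contra c1 => /eqP/eq0_normc ->.
  have np : 0 < normc c by rewrite lt0r n0 normc_ge0.
  rewrite -ler_pdivlMl // -normcV; apply: le_trans (le _ _).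
  by rewrite scalerA mulVf // scale1r.
apply: adj_ext => x; apply: (nm_le0 NF).
by apply: le_trans (opnorm_le T x) _; rewrite T0 mul0r.
Qed.

Lemma opnorm_complete : rate_complete (fun T => opnorm T).
Proof.
move=> u d hd hu.
have hT x m n : (n <= m)%N -> ipm_norm (u m x - u n x) <= ipm_norm x * d n.
  move=> nm; apply: le_trans (opnorm_le (u m - u n) x) _.
  by rewrite mulrC; apply: ler_wpM2l; [exact: nm_ge0|exact: hu].
have hS y m n : (n <= m)%N -> ipm_norm (adj (u m) y - adj (u n) y) <= ipm_norm y * d n.
  move=> nm.
  have -> : adj (u m) y - adj (u n) y = adj (u m - u n) y.
    apply/esym/(@adj_uniq _ (fun y => adj (u m) y - adj (u n) y)) => x z.
    by rewrite ipBr -!adjP -ipBl.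
  apply: le_trans (adj_le (u m - u n) y) _.
  by rewrite mulrC; apply: ler_wpM2l; [exact: nm_ge0|exact: hu].
have cT x := banach_complete (hm_banach hF) (rateM (nm_ge0 NE x) hd) (hT x).
have cS y := banach_complete (hm_banach hE) (rateM (nm_ge0 NF y) hd) (hS y).
pose T x := projT1 (cid (cT x)); pose S y := projT1 (cid (cS y)).
have TE x n : ipm_norm (u n x - T x) <= ipm_norm x * d n := projT2 (cid (cT x)) n.
have SE y n : ipm_norm (adj (u n) y - S y) <= ipm_norm y * d n := projT2 (cid (cS y)) n.
have TS : adjoint_pair T S.
  move=> x y; have K0 : 0 <= 2 * (ipm_norm x * ipm_norm y).
    by rewrite mulr_ge0 // mulr_ge0 ?(nm_ge0 NE) ?(nm_ge0 NF).
  apply: (nm_rate_eq NA (rateM K0 hd)) => n.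
  apply: le_trans (nmT NA (ipm_ip (u n x) y) _ _) _.
  rewrite {2}adjP -ipBl -ipBr.
  have -> : 2 * (ipm_norm x * ipm_norm y) * d n =
    ipm_norm x * d n * ipm_norm y + ipm_norm x * (ipm_norm y * d n) by ring.
  apply: lerD.
    apply: le_trans (hm_cs hF _ _) _; apply: ler_wpM2r; first exact: nm_ge0.
    by rewrite (nmB NF).
  by apply: le_trans (hm_cs hE _ _) _; apply: ler_wpM2l; first exact: nm_ge0.
have d0 n : 0 <= d n by apply: le_trans (hu n n (leqnn n)); exact: opnorm_ge0.
exists (mk_adj TS) => n; apply: opnorm_lub => // x.
by rewrite mulrC; exact: TE.
Qed.

Lemma opnorm_banach : @is_banach R (adj_op E F) (fun T => opnorm T).
Proof. exact: norm_banach opnorm_is_norm opnorm_complete. Qed.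

End pair.

Section composition.
Variables (E F G : ipmod A) (hE : hmod E) (hF : hmod F) (hG : hmod G).

Lemma adj_adjK (T : adj_op E F) : adj (adj T) = T.
Proof. by apply: adj_ext => x; apply: (adj_uniq hF); exact/adjoint_pair_sym/adjP. Qed.

Lemma opnorm_adj (T : adj_op E F) : opnorm (adj T) = opnorm T.
Proof.
have le E1 F1 (h1 : hmod E1) (h2 : hmod F1) (S : adj_op E1 F1) : opnorm (adj S) <= opnorm S.
  apply: (opnorm_lub h2 h1); first exact: opnorm_ge0.
  exact: adj_le.
by apply/eqP; rewrite eq_le le //= -{1}(adj_adjK T) le.
Qed.

Lemma opnorm_comp (S : adj_op F G) (T : adj_op E F) :
  opnorm (adj_comp S T) <= opnorm S * opnorm T.
Proof.
apply: (opnorm_lub hE hG); first by rewrite mulr_ge0 ?(opnorm_ge0 hF hG) ?(opnorm_ge0 hE hF).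
move=> x; apply: le_trans (opnorm_le hF hG S (T x)) _; rewrite -mulrA.
by apply: ler_wpM2l; [exact: (opnorm_ge0 hF hG)|exact: opnorm_le].
Qed.

Lemma adj_compE (S : adj_op F G) (T : adj_op E F) :
  adj (adj_comp S T) = adj_comp (adj T) (adj S).
Proof.
apply: adj_ext => y; apply: (adj_uniq hE) => x z /=.
by rewrite (adjP S) (adjP T).
Qed.

Lemma opnorm_C (T : adj_op E F) : opnorm (adj_comp (adj T) T) = opnorm T ^+ 2.
Proof.
apply/eqP; rewrite eq_le; apply/andP; split.
  have := @opnorm_lub _ _ hE hE (adj_comp (adj T) T) (opnorm T ^+ 2); apply.
    exact: sqr_ge0.
  move=> x; apply: le_trans (adj_le hE hF T (T x)) _; rewrite expr2 -mulrA.
  by apply: ler_wpM2l; [exact: (opnorm_ge0 hE hF)|exact: opnorm_le].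
set K := opnorm (adj_comp _ _); have K0 : 0 <= K by exact: (opnorm_ge0 hE hE).
rewrite -[leRHS](sqr_sqrtr K0) ler_sqr ?nnegrE ?sqrtr_ge0 ?(opnorm_ge0 hE hF) //.
apply: (opnorm_lub hE hF); first exact: sqrtr_ge0.
have NE := hm_norm hE; have NF := hm_norm hF.
move=> x; rewrite -ler_sqr ?nnegrE ?mulr_ge0 ?sqrtr_ge0 ?(nm_ge0 NE) ?(nm_ge0 NF) //.
rewrite (hm_sq hF) exprMn (sqr_sqrtr K0) (adjP T).
apply: le_trans (hm_cs hE _ _) _; rewrite mulrC expr2 mulrA.
by apply: ler_wpM2r; [exact: nm_ge0|exact: (opnorm_le hE hE (adj_comp (adj T) T))].
Qed.

Lemma adjD (S T : adj_op E F) : adj (S + T) = adj S + adj T.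
Proof.
apply: adj_ext => y.
apply: (@adj_uniq _ _ hE (S + T) (fun y => adj S y + adj T y)) => x z.
by rewrite ipDr -!adjP -ipDl.
Qed.

Lemma adjZ (c : R[i]) (T : adj_op E F) : adj (c *: T) = c^* *: adj T.
Proof.
apply: adj_ext => y.
apply: (@adj_uniq _ _ hE (c *: T) (fun y => c^* *: adj T y)) => x z.
by rewrite ipZr -!adjP -ipZl.
Qed.

Lemma adj_compDl (S S' : adj_op F G) (T : adj_op E F) (c : R[i]) :
  adj_comp (c *: S + S') T = c *: adj_comp S T + adj_comp S' T.
Proof. exact: adj_ext. Qed.

Lemma adj_compDr (S : adj_op F G) (T T' : adj_op E F) (c : R[i]) :
  adj_comp S (c *: T + T') = c *: adj_comp S T + adj_comp S T'.
Proof. by apply: adj_ext => x; exact: (pair_linear hG _ _ _ (adjP S)). Qed.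

End composition.

Lemma adj_alg_cstar E : hmod E -> is_cstar (adj_alg E).
Proof.
move=> hE; split => /=.
- exact: opnorm_banach.
- by move=> S T U; exact: adj_ext.
- by move=> T c S S'; exact: adj_compDl.
- by move=> T c S S'; exact: (adj_compDr hE).
- by move=> S T; exact: opnorm_comp.
- by move=> S T; exact: (adjD hE).
- by move=> c T; exact: (adjZ hE).
- by move=> T; exact: (adj_adjK hE).
- by move=> S T; exact: (adj_compE hE).
by move=> T; exact: opnorm_C.
Qed.

Lemma adj_one_proof E : @adjoint_pair R A E E id id.
Proof. by []. Qed.

Definition adj_one E : adj_op E E := mk_adj (@adj_one_proof E).

(** L(E) as a C*-algebra. *)
Definition adj_calg E (hE : hmod E) : cstarAlg R := CstarAlg (adj_alg_cstar hE).

Lemma adj_comp1l E F (T : adj_op E F) : adj_comp (adj_one F) T = T.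
Proof. exact: adj_ext. Qed.

Lemma adj_comp1r E F (T : adj_op E F) : adj_comp T (adj_one E) = T.
Proof. exact: adj_ext. Qed.

(** L(E) as a unital C*-algebra. *)
Definition adj_ucalg E (hE : hmod E) : ucstar R :=
  @UCstar R (adj_calg hE) (adj_one E) (@adj_comp1l E E) (@adj_comp1r E E).

End hilbert.

(** * Positive operators on Hilbert modules *)

Section positivity.
Variables (R : realType) (A : cstarAlg R).
Let AP := cstarP A.
Let NA : is_norm (@cs_norm R A) := cs_is_norm A.

Lemma self_hmod : hmod (self_mod A).
Proof.
split=> [|x|x y] /=; first exact: cs_banach AP.
  by rewrite (cs_norm_star AP).
by apply: le_trans (cs_normM AP _ _) _; rewrite cs_norm_starE.
Qed.

(** The embedding of A in M(A) is isometric. *)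
Lemma opnorm_iotaA (a : A) : opnorm (iotaA a) = cs_norm a.
Proof.
apply/eqP; rewrite eq_le; apply/andP; split.
  apply: (opnorm_lub self_hmod self_hmod); first exact: nm_ge0.
  by move=> x; exact: cs_normM.
have [->|a0] := eqVneq a 0; first by rewrite (nm0 NA); exact: (opnorm_ge0 self_hmod self_hmod).
have ap : 0 < cs_norm a.
  rewrite lt0r (nm_ge0 NA) andbT.
  by apply: contra a0 => /eqP/(nm0_eq0 NA) ->.
rewrite -(ler_pM2r ap) -expr2 -cs_norm_star2.
apply: le_trans (opnorm_le self_hmod self_hmod (iotaA a) (cs_star a)) _.
by rewrite /= cs_norm_starE.
Qed.

Lemma iotaA_linear : linear (@iotaA R A : A -> mult_alg A).
Proof.
move=> c a b; apply: adj_ext => x /=.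
by rewrite cs_mulDl cs_mulZl.
Qed.

Lemma iotaAM (a b : A) : iotaA (cs_mul a b) = adj_comp (iotaA a) (iotaA b).
Proof. by apply: adj_ext => x /=; rewrite (cs_mulA AP). Qed.

Lemma adj_iotaA (a : A) : adj (iotaA a) = iotaA (cs_star a).
Proof. by apply: adj_ext => x; exact: (adj_uniq self_hmod (T := iotaA a) (iotaA_adjoint a)). Qed.

Lemma iotaA_star_hom : is_star_hom (@iotaA R A : A -> mult_alg A).
Proof.
split; [exact: iotaA_linear|exact: iotaAM|by move=> a; rewrite -adj_iotaA].
Qed.

Lemma iotaA_inj : injective (@iotaA R A).
Proof.
move=> a b ab; apply/eqP; rewrite -subr_eq0; apply/eqP/(nm0_eq0 NA).
rewrite -opnorm_iotaA addrC -scaleN1r iotaA_linear ab scaleN1r addNr.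
exact: nm0 (opnorm_is_norm self_hmod self_hmod).
Qed.

(** The norm of A is monotone on positive elements; the unital theory applies
    to the images in M(A). *)
Lemma cs_norm_mono (p q : A) : cs_pos p -> cs_pos q -> cs_norm p <= cs_norm (p + q).
Proof.
move=> [d ->] [b ->]; have := psq_mono (U := adj_ucalg self_hmod)
  (psq_starM (iotaA d : ucar (adj_ucalg self_hmod)))
  (psq_starM (iotaA b : ucar (adj_ucalg self_hmod))).
rewrite -!opnorm_iotaA -[X in iotaA (X + _)]scale1r iotaA_linear scale1r.
by rewrite !iotaAM -!adj_iotaA.
Qed.

(** Operators that are positive as quadratic forms have square roots.  After
    scaling, let k be the square root of 1 - h; then <k x, k x> and <x, h x> add
    up to <x, x>, so |k| <= 1 and |1 - h| = |k ^ 2| <= 1. *)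
Lemma op_pos (E : ipmod A) (hE : hmod E) (h : adj_op E E) :
  (forall x : E, cs_pos (ipm_ip x x)) -> adj h = h ->
  (forall x : E, cs_pos (ipm_ip x (h x))) ->
  exists k : adj_op E E, adj k = k /\ h = adj_comp k k.
Proof.
move=> pE hh ph; pose U := adj_ucalg hE; pose T := ucar U.
have NU := opnorm_is_norm hE hE.
pose s := 1 + opnorm h.
have s0 : 0 < s by have := opnorm_ge0 hE hE h; rewrite /s; lra.
have si : 0 <= s^-1 by rewrite invr_ge0 ltW.
pose g : T := (s^-1%:C)%C *: (h : T).
have hg : ustar g = g by rewrite ustarZr /ustar /= hh.
have g1 : unorm g <= 1.
  rewrite [unorm g](nmZr NU) ger0_norm // mulrC ler_pdivrMr // /s mul1r.
  by rewrite lerDr.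
have [k [hk kE]] : exists k : T, ustar k = k /\ k * k = 1 - g.
  by exists (usqrt g); rewrite usqrt_star // usqrt_sq.
have k1 : unorm k <= 1.
  pose k' : adj_op E E := k.
  have : opnorm k' <= 1.
    apply: (opnorm_lub hE hE) => // x; rewrite mul1r.
    have NE := hm_norm hE.
    rewrite -ler_sqr ?nnegrE ?(nm_ge0 NE) // !(hm_sq hE).
    have hk' : adj k' = k' := hk.
    have kE' : adj_comp k' k' = adj_one E - ((s^-1%:C)%C *: h) := kE.
    have e : ipm_ip (k' x) (k' x) = ipm_ip x x - ipm_ip x ((s^-1%:C)%C *: h x).
      rewrite (adjP k') hk' -[k' (k' x)]/(adj_comp k' k' x) kE' /=.
      by rewrite -ipBr.
    have := cs_norm_mono (pE (k' x)) (q := ipm_ip x ((s^-1%:C)%C *: h x)).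
    rewrite {2}e subrK; apply.
    have [b hb] := ph x; exists (((Num.sqrt s^-1)%:C)%C *: b).
    rewrite ipZr hb (cs_starZ AP) conjC_realc cs_mulZl cs_mulZr scalerA.
    by rewrite -rmorphM -expr2 sqr_sqrtr.
  by [].
have : psq g.
  apply: near_psq => //; rewrite -kE.
  exact: unormsq_le1.
by move/(psqZ (ltW s0)); rewrite rsK ?gt_eqF.
Qed.

End positivity.

(** * Closed linear spans *)

Lemma linear_subr (K : pzRingType) (V W : lmodType K) (f : V -> W) x y :
  linear f -> f (x - y) = f x - f y.
Proof. by move=> lf; rewrite addrC -scaleN1r lf scaleN1r addrC. Qed.

Lemma linear_at0 (K : pzRingType) (V W : lmodType K) (f : V -> W) :
  linear f -> f 0 = 0.
Proof. by move=> lf; rewrite -(subrr 0) linear_subr // subrr. Qed.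

Section spans.
Variables (R : realType) (V : lmodType R[i]) (nrm : V -> R).

(** Induction on the closed linear span. *)
Lemma closed_span_ind (S P : set V) : P 0 ->
  (forall (c : R[i]) x y, P x -> P y -> P (c *: x + y)) -> S `<=` P ->
  nclosure nrm P `<=` P -> closed_span nrm S `<=` P.
Proof.
move=> P0 PL SP clP x hx; apply: clP => e e0.
have [s [n [c [v [Sv ->]]]] hs] := hx e e0.
exists (\sum_(i < n) c i *: v i) => //.
by apply: big_ind => [|a b Pa Pb|i _] //; [rewrite -[a]scale1r; exact: PL|
  rewrite -[_ *: _]addr0; apply: PL => //; exact: SP].
Qed.

Lemma sub_closed_span (S : set V) : is_norm nrm -> S `<=` closed_span nrm S.
Proof.
move=> N x Sx e e0; exists x; last by rewrite subrr (nm0 N).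
exists 1%N, (fun=> 1), (fun=> x); split=> //.
by rewrite big_ord1 scale1r.
Qed.

Lemma closed_span0 (S : set V) : is_norm nrm -> closed_span nrm S 0.
Proof.
move=> N e e0; exists 0; last by rewrite subrr (nm0 N).
exists 0%N, (fun=> 0), (fun=> 0); split=> [[]|] //.
by rewrite big_ord0.
Qed.

Lemma closed_span_lin (S : set V) (c : R[i]) x y : is_norm nrm ->
  closed_span nrm S x -> closed_span nrm S y -> closed_span nrm S (c *: x + y).
Proof.
move=> N hx hy e e0; have K0 : 0 < normc c + 1 by rewrite ltr_wpDl ?normc_ge0.
have e1 : 0 < e / 2 / (normc c + 1) by rewrite !divr_gt0.
have e2 : 0 < e / 2 by rewrite divr_gt0.
have [_ [n [d [v [Sv ->]]]] hs] := hx _ e1.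
have [_ [m [d' [v' [Sv' ->]]]] hs'] := hy _ e2.
set s := \sum_(i < n) _ in hs; set s' := \sum_(i < m) _ in hs'.
exists (c *: s + s').
  exists (n + m)%N, (fun i => match split i with inl j => c * d j | inr j => d' j end),
    (fun i => match split i with inl j => v j | inr j => v' j end).
  split=> [i|]; first by case: split.
  rewrite big_split_ord /= scaler_sumr; congr (_ + _); apply: eq_bigr => i _.
    by rewrite (unsplitK (inl i)) scalerA.
  by rewrite (unsplitK (inr i)).
rewrite opprD addrACA -scalerBr; apply: le_lt_trans (nmD N _ _) _.
rewrite (nmZ N) (splitr e); apply: ler_ltD => //.
move: hs; rewrite ltr_pdivlMr // => /ltW hs; apply: le_trans hs.
by rewrite mulrC; apply: ler_wpM2l; [exact: nm_ge0|rewrite lerDl].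
Qed.

Lemma closed_span_closed (S : set V) : is_norm nrm ->
  nclosure nrm (closed_span nrm S) `<=` closed_span nrm S.
Proof.
move=> N x hx e e0; have e2 : 0 < e / 2 by rewrite divr_gt0.
have [y hy xy] := hx _ e2; have [s Ss ys] := hy _ e2; exists s => //.
by apply: le_lt_trans (nmT N y _ _) _; rewrite (splitr e) ltrD.
Qed.

Lemma closed_span_sub (S S' : set V) : is_norm nrm ->
  S `<=` closed_span nrm S' -> closed_span nrm S `<=` closed_span nrm S'.
Proof.
move=> N h; apply: closed_span_ind => //; last exact: closed_span_closed.
- exact: closed_span0.
- by move=> c x y; exact: closed_span_lin.
Qed.

(** Equalizers of Lipschitz maps are closed. *)
Lemma eq_nclosure (W : lmodType R[i]) (nrmW : W -> R) (f g : V -> W) (K : R) :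
  is_norm nrmW -> 0 <= K ->
  (forall x y, nrmW (f x - f y) <= K * nrm (x - y)) ->
  (forall x y, nrmW (g x - g y) <= K * nrm (x - y)) ->
  is_norm nrm -> nclosure nrm [set x | f x = g x] `<=` [set x | f x = g x].
Proof.
move=> NW K0 hf hg N x hx /=.
have K2 : 0 <= 2 * K by rewrite mulr_ge0.
apply: (nm_rate_eq NW (rateM K2 (@rate_inv R))) => n.
have [|y /= fg hy] := hx n.+1%:R^-1; first by rewrite invr_gt0 ltr0Sn.
move: hy; set q : R := n.+1%:R^-1 => hy.
apply: le_trans (nmT NW (f y) _ _) _; rewrite {2}fg.
have := ler_wpM2l K0 (ltW hy).
have := hf x y; have := hg y x; rewrite (nmB N y x); lra.
Qed.

End spans.

(** * The Cauchy--Schwarz inequality *)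

Section growth.
Variable R : realType.

(** A sequence with r_n ^ 2 <= r_(n+1) and r_0 > 1 would grow at least
    linearly. *)
Lemma square_bounded (r : nat -> R) K :
  (forall n, 0 <= r n) -> (forall n, r n ^+ 2 <= r n.+1) ->
  (forall n, r n <= K) -> r 0%N <= 1.
Proof.
move=> r0 rS rK; rewrite leNgt; apply/negP => r1.
pose e := r 0%N - 1; have e0 : 0 < e by rewrite subr_gt0.
have h n : 1 + n.+1%:R * e <= r n.
  elim: n => [|n IH]; first by rewrite mul1r addrC subrK.
  apply: le_trans (rS n); have n0 : 0 <= n%:R :> R by [].
  apply: (@le_trans _ _ ((1 + n.+1%:R * e) ^+ 2)).
    rewrite -natr1 -[n.+1%:R]natr1; nra.
  by rewrite ler_sqr ?nnegrE // addr_ge0 // mulr_ge0 // ltW.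
have := h (Num.truncn (K / e)); have := rK (Num.truncn (K / e)).
have := truncnS_gt (K / e); rewrite ltr_pdivrMr //; lra.
Qed.

Variable A : cstarAlg R.
Let AP := cstarP A.
Let NA : is_norm (@cs_norm R A) := cs_is_norm A.

(** Polarization bounds the self-adjoint and the skew-adjoint part of <x, y> on
    the unit ball. *)
Lemma ip_crude (E : ipmod A) (x y : E) : is_norm (@ipm_norm _ _ E) ->
  (forall x : E, ipm_norm x ^+ 2 = cs_norm (ipm_ip x x)) ->
  ipm_norm x <= 1 -> ipm_norm y <= 1 -> cs_norm (ipm_ip x y) <= 4.
Proof.
move=> N sq x1 y1.
have half (z : E) : ipm_norm z <= 1 ->
    cs_norm (ipm_ip x z + ipm_ip z x) <= 4.
  move=> z1.
  have q (w : E) : ipm_norm w <= 2 -> cs_norm (ipm_ip w w) <= 4.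
    by move=> w2; rewrite -sq; have := nm_ge0 N w; nra.
  have h1 : ipm_norm (x + z) <= 2 by apply: le_trans (nmD N _ _) _; lra.
  have h2 : ipm_norm (x - z) <= 2.
    by apply: le_trans (nmD N _ _) _; rewrite (nmN N); lra.
  have := nmD NA (ipm_ip (x + z) (x + z)) (- ipm_ip (x - z) (x - z)).
  have -> : ipm_ip (x + z) (x + z) - ipm_ip (x - z) (x - z) =
    (ipm_ip x z + ipm_ip z x) + (ipm_ip x z + ipm_ip z x).
    rewrite ipDl ipBl !ipDr !ipNr.
    set a := ipm_ip x x; set b := ipm_ip x z; set c := ipm_ip z x; set d := ipm_ip z z.
    have e1 : a + b + (b - a) = b + b by rewrite addrC addrA subrK.
    have e2 : c + d + (c - d) = c + c by rewrite addrACA subrr addr0.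
    by rewrite !opprB [c - d + _]addrC addrACA e1 e2 addrACA.
  rewrite (nm_dbl NA) (nmN NA); have := q _ h1; have := q _ h2; lra.
have h1 := half y y1.
have h2 : cs_norm (ipm_ip x y - ipm_ip y x) <= 4.
  have iy : ipm_norm ('i *: y) <= 1.
    by rewrite (nmZ N) /normc /= expr0n /= expr1n add0r sqrtr1 mul1r.
  have := half _ iy; rewrite ipZr ipZl conjCi scaleNr -scalerBr (nmZ NA).
  by rewrite /normc /= expr0n /= expr1n add0r sqrtr1 mul1r.
have := nmD NA (ipm_ip x y + ipm_ip y x) (ipm_ip x y - ipm_ip y x).
rewrite addrACA subrr addr0 (nm_dbl NA); lra.
Qed.
End growth.

Section cauchy_schwarz.
Variables (R : realType) (A : cstarAlg R).
Let AP := cstarP A.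
Let NA : is_norm (@cs_norm R A) := cs_is_norm A.

(** If the square of |<x, y>| is always at most |<x', y'>| for some other pair of
    the unit ball, then |<x, y>| <= 1 on the unit ball. *)
Lemma ip_cs (E : ipmod A) (ax ay : E -> E -> E) :
  is_norm (@ipm_norm _ _ E) ->
  (forall x : E, ipm_norm x ^+ 2 = cs_norm (ipm_ip x x)) ->
  (forall x y, ipm_norm x <= 1 -> ipm_norm y <= 1 ->
    [/\ ipm_norm (ax x y) <= 1, ipm_norm (ay x y) <= 1 &
        cs_norm (ipm_ip x y) ^+ 2 <= cs_norm (ipm_ip (ax x y) (ay x y))]) ->
  forall x y : E, cs_norm (ipm_ip x y) <= ipm_norm x * ipm_norm y.
Proof.
move=> N sq imp.
have unit_cs (x y : E) : ipm_norm x <= 1 -> ipm_norm y <= 1 -> cs_norm (ipm_ip x y) <= 1.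
  move=> x1 y1.
  pose p n := iter n (fun p => (ax p.1 p.2, ay p.1 p.2)) (x, y).
  have p1 n : ipm_norm (p n).1 <= 1 /\ ipm_norm (p n).2 <= 1.
    by elim: n => [|n [h1 h2]] //=; have [] := imp _ _ h1 h2.
  apply: (@square_bounded _ (fun n => cs_norm (ipm_ip (p n).1 (p n).2)) 4) => n.
  - exact: nm_ge0.
  - by have [h1 h2] := p1 n; have [] := imp _ _ h1 h2.
  by have [h1 h2] := p1 n; exact: ip_crude.
move=> x y.
have [x0|x0] := eqVneq (ipm_norm x) 0.
  rewrite (nm0_eq0 N x0) (nm0 N) mul0r.
  by rewrite (ipr_star (ipmP E) y 0) ip0r cs_star0 (nm0 NA).
have [y0|y0] := eqVneq (ipm_norm y) 0.
  by rewrite (nm0_eq0 N y0) (nm0 N) mulr0 ip0r (nm0 NA).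
have xi : 0 <= (ipm_norm x)^-1 by rewrite invr_ge0 (nm_ge0 N).
have yi : 0 <= (ipm_norm y)^-1 by rewrite invr_ge0 (nm_ge0 N).
have := unit_cs (((ipm_norm x)^-1)%:C%C *: x) (((ipm_norm y)^-1)%:C%C *: y).
rewrite !(nmZr N) !ger0_norm // !mulVf // lexx => /(_ isT isT).
rewrite ipZl ipZr conjC_realc !(nmZr NA) !ger0_norm // mulrA -invfM mulrC.
by rewrite ler_pdivrMr ?mul1r // lt0r mulf_neq0 //= mulr_ge0 ?(nm_ge0 N).
Qed.

End cauchy_schwarz.

(** * The ideal of A in M(A) *)

Section multiplier_algebra.
Variables (R : realType) (A : cstarAlg R).
Let AP := cstarP A.
Let NA : is_norm (@cs_norm R A) := cs_is_norm A.
Let hA := self_hmod A.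
Notation opA := (adj_op (self_mod A) (self_mod A)).
Implicit Types (M : opA) (a b : A).

Lemma mult_mulr M a b : M (cs_mul a b) = cs_mul (M a) b.
Proof.
apply: (ip_inj hA) => z; rewrite (adjP M) /= !(cs_starM AP) -!(cs_mulA AP).
by congr (cs_mul _ _); exact: (esym (adjP M a z)).
Qed.

(** The product [b M] of an element of A with a multiplier, as an element of A. *)
Definition rmul M b : A := cs_star (adj M (cs_star b)).

Lemma rmulE M b a : cs_mul (rmul M b) a = cs_mul b (M a).
Proof.
rewrite /rmul; have := adjoint_pair_sym (adjP M) (cs_star b) a.
by rewrite /= (cs_starK AP).
Qed.

Lemma mult_iotaA M a : adj_comp M (iotaA a) = iotaA (M a).
Proof. by apply: adj_ext => b /=; exact: mult_mulr. Qed.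

Lemma iotaA_mult M a : adj_comp (iotaA a) M = iotaA (rmul M a).
Proof. by apply: adj_ext => b /=; rewrite rmulE. Qed.

Lemma iotaAB a b : iotaA (a - b) = iotaA a - iotaA b.
Proof. exact: (linear_subr _ _ (@iotaA_linear R A)). Qed.

Lemma iotaA0 : iotaA (0 : A) = 0.
Proof. exact: (linear_at0 (@iotaA_linear R A)). Qed.

(** M a = M(a) and a M are in A, and A is complete, hence closed in M(A). *)
Lemma iotaA_ideal : @is_ideal R (mult_alg A) (range (@iotaA R A)).
Proof.
have NM := opnorm_is_norm hA hA.
split.
- by exists 0 => //; exact: iotaA0.
- by move=> c _ _ [a _ <-] [b _ <-]; exists (c *: a + b) => //; exact: iotaA_linear.
- move=> M hM.
  have ex n : exists a, opnorm (M - iotaA a : opA) < n.+1%:R^-1.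
    have [|_ [a _ <-] h] := hM n.+1%:R^-1; first by rewrite invr_gt0 ltr0Sn.
    by exists a.
  pose u n := projT1 (cid (ex n)).
  have hu n : opnorm (M - iotaA (u n) : opA) < n.+1%:R^-1 := projT2 (cid (ex n)).
  have cu m n : (n <= m)%N -> cs_norm (u m - u n) <= 2 * n.+1%:R^-1.
    move=> nm; rewrite -opnorm_iotaA iotaAB.
    apply: le_trans (nmT NM M _ _) _; rewrite mulr_natl mulr2n lerD // ?(ltW (hu _)) //.
    rewrite (nmB NM); apply: le_trans (ltW (hu m)) _.
    by rewrite lef_pV2 ?posrE ?ltr0Sn // ler_nat.
  have [a ha] := banach_complete (cs_banach AP) (rateM (ler0n R 2) (@rate_inv R)) cu.
  exists a => //; apply/esym.
  apply: (nm_rate_eq NM (rateM (ler0n R 3) (@rate_inv R))) => n.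
  apply: le_trans (nmT NM (iotaA (u n)) _ _) _.
  have -> : (3 : R) * n.+1%:R^-1 = n.+1%:R^-1 + 2 * n.+1%:R^-1 by ring.
  apply: lerD; first exact: ltW.
  by rewrite -iotaAB opnorm_iotaA.
- by move=> M _ [a _ <-]; exists (M a) => //; rewrite -mult_iotaA.
by move=> M _ [a _ <-]; exists (rmul M a) => //; rewrite -iotaA_mult.
Qed.

Lemma iotaA_essential : @is_essential_ideal R (mult_alg A) (range (@iotaA R A)).
Proof.
split; first exact: iotaA_ideal.
move=> J hJ J0.
have [M JM M0] : exists2 M : opA, J M & M <> 0.
  apply: contrapT => h; move/eqP: J0; apply; apply/seteqP; split=> [M JM|_ ->].
    by apply: contrapT => M0; apply: h; exists M.
  exact: (id_0 hJ).
have [a Ma] : exists a, M a <> 0.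
  apply: contrapT => h; apply: M0; apply: adj_ext => a.
  by apply: contrapT => Ma; apply: h; exists a.
apply/eqP => e.
have : [set (0 : opA)] (iotaA (M a)).
  rewrite -e; split; first by exists (M a).
  by rewrite -mult_iotaA; exact: (id_mulr hJ).
by rewrite /= -iotaA0 => /iotaA_inj.
Qed.

End multiplier_algebra.

(** * Full Hilbert bimodules *)

Section bimodule.
Variables (R : realType) (A : cstarAlg R) (X : hilbertBimod A).
Let AP := cstarP A.
Let NA : is_norm (@cs_norm R A) := cs_is_norm A.
Let XR := hb_right (hbP X).
Let XL := hb_left (hbP X).
Implicit Types (a b c : A) (x y z : X).

Lemma bm_is_norm : is_norm (@bm_norm R A X).
Proof. exact: banach_norm (rh_banach XR). Qed.
Let NX := bm_is_norm.

Lemma bm_sqr x : bm_norm x ^+ 2 = cs_norm (rip x x).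
Proof. by rewrite (rh_norm XR) sqr_sqrtr // (nm_ge0 NA). Qed.

Lemma bm_sql x : bm_norm x ^+ 2 = cs_norm (lip x x).
Proof. by rewrite (lh_norm XL) sqr_sqrtr // (nm_ge0 NA). Qed.

Lemma lactDl a b x : lact (a + b) x = lact a x + lact b x.
Proof. by have := lh_act_linearl XL x 1 a b; rewrite !scale1r. Qed.
Lemma lactDr a x y : lact a (x + y) = lact a x + lact a y.
Proof. by have := lh_act_linearr XL a 1 x y; rewrite !scale1r. Qed.
Lemma lact0l x : lact 0 x = 0.
Proof. by apply: (addrI (lact 0 x)); rewrite -lactDl !addr0. Qed.
Lemma lact0r a : lact a (0 : X) = 0.
Proof. by apply: (addrI (lact a 0)); rewrite -lactDr !addr0. Qed.
Lemma lactZl (k : R[i]) a x : lact (k *: a) x = k *: lact a x.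
Proof. by have := lh_act_linearl XL x k a 0; rewrite !addr0 lact0l addr0. Qed.
Lemma lactZr (k : R[i]) a x : lact a (k *: x) = k *: lact a x.
Proof. by have := lh_act_linearr XL a k x 0; rewrite !addr0 lact0r addr0. Qed.
Lemma lactBl a b x : lact (a - b) x = lact a x - lact b x.
Proof. by rewrite lactDl -scaleN1r lactZl scaleN1r. Qed.
Lemma lactBr a x y : lact a (x - y) = lact a x - lact a y.
Proof. by rewrite lactDr -scaleN1r lactZr scaleN1r. Qed.

Lemma lipDl x y z : lip (x + y) z = lip x z + lip y z.
Proof. by have := lh_ip_linear XL z 1 x y; rewrite !scale1r. Qed.
Lemma lip0l z : lip (0 : X) z = 0.
Proof. by apply: (addrI (lip 0 z)); rewrite -lipDl !addr0. Qed.
Lemma lipZl (k : R[i]) x z : lip (k *: x) z = k *: lip x z.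
Proof. by have := lh_ip_linear XL z k x 0; rewrite !addr0 lip0l addr0. Qed.
Lemma lipNl x z : lip (- x) z = - lip x z.
Proof. by rewrite -scaleN1r lipZl scaleN1r. Qed.
Lemma lip_lactr a x y : lip x (lact a y) = cs_mul (lip x y) (cs_star a).
Proof.
by rewrite (lh_ip_star XL) (lh_ip_act XL) (cs_starM AP) -(lh_ip_star XL).
Qed.
Lemma rip_ractl a x y : rip (ract x a) y = cs_mul (cs_star a) (rip x y).
Proof.
by rewrite (ipr_star (rh_ip XR)) (rh_ip_act XR) (cs_starM AP) -(ipr_star (rh_ip XR)).
Qed.

Lemma lact_norm a x : bm_norm (lact a x) <= cs_norm a * bm_norm x.
Proof.
rewrite -ler_sqr ?nnegrE ?mulr_ge0 ?(nm_ge0 NX) ?(nm_ge0 NA) //.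
rewrite bm_sql (lh_ip_act XL) lip_lactr exprMn bm_sql.
apply: le_trans (cs_normM AP _ _) _; rewrite expr2 -mulrA.
apply: ler_wpM2l; first exact: nm_ge0.
by apply: le_trans (cs_normM AP _ _) _; rewrite cs_norm_starE mulrC.
Qed.

Lemma ract_norm a x : bm_norm (ract x a) <= cs_norm a * bm_norm x.
Proof.
rewrite -ler_sqr ?nnegrE ?mulr_ge0 ?(nm_ge0 NX) ?(nm_ge0 NA) //.
rewrite bm_sqr (rh_ip_act XR) rip_ractl exprMn bm_sqr.
apply: le_trans (cs_normM AP _ _) _; rewrite mulrC expr2 -mulrA.
apply: ler_wpM2l; first exact: nm_ge0.
by apply: le_trans (cs_normM AP _ _) _; rewrite cs_norm_starE.
Qed.

(** The pair (x, y) is improved to (y, h y) with h = lip x x. *)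
Lemma rip_cs x y : cs_norm (rip x y) <= bm_norm x * bm_norm y.
Proof.
apply: (@ip_cs _ _ (rmod X) (fun x y => y) (fun x y => lact (lip x x) y)) => //.
- exact: bm_sqr.
move=> {}x {}y /= x1 y1; split=> //.
  apply: le_trans (lact_norm _ _) _; rewrite -[leRHS]mulr1.
  by apply: ler_pM; rewrite ?(nm_ge0 NA) ?(nm_ge0 NX) // -bm_sql expr_le1 // (nm_ge0 NX).
by rewrite (hb_compat (hbP X)) (rh_ip_act XR) [rip y x](ipr_star (rh_ip XR)) (cs_norm_star AP).
Qed.

(** Exchanging the arguments of the left inner product makes it linear in the
    second variable, as right inner products are. *)
Lemma lip_inner : inner_productr (fun x y => lip y x).
Proof.
split=> [x|x y]; first exact: (lh_ip_linear XL).
exact: (lh_ip_star XL).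
Qed.

Lemma lip_cs x y : cs_norm (lip x y) <= bm_norm x * bm_norm y.
Proof.
rewrite mulrC.
apply: (@ip_cs _ _ (Ipmod (@bm_norm R A X) lip_inner)
          (fun x y => y) (fun x y => ract y (rip x x))) => //.
- exact: bm_sql.
move=> {}x {}y /= x1 y1; split=> //.
  apply: le_trans (ract_norm _ _) _; rewrite -[leRHS]mulr1.
  by apply: ler_pM; rewrite ?(nm_ge0 NA) ?(nm_ge0 NX) // -bm_sqr expr_le1 // (nm_ge0 NX).
by rewrite -(hb_compat (hbP X)) (lh_ip_act XL) [lip x y](lh_ip_star XL) cs_norm_star2.
Qed.

Lemma rmod_hmod : hmod (rmod X).
Proof. by split; [exact: rh_banach XR|exact: bm_sqr|exact: rip_cs]. Qed.

Lemma ripDl x y z : rip (x + y) z = rip x z + rip y z.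
Proof. exact: (@ipDl _ _ (rmod X)). Qed.
Lemma ripDr x y z : rip x (y + z) = rip x y + rip x z.
Proof. exact: (@ipDr _ _ (rmod X)). Qed.
Lemma rip0r x : rip x 0 = 0.
Proof. exact: (@ip0r _ _ (rmod X)). Qed.
Lemma rip0l x : rip 0 x = 0.
Proof. by rewrite (ipr_star (rh_ip XR)) rip0r cs_star0. Qed.
Lemma ripZl (c : R[i]) x y : rip (c *: x) y = c^* *: rip x y.
Proof. exact: (@ipZl _ _ (rmod X)). Qed.
Lemma ripZr (c : R[i]) x y : rip x (c *: y) = c *: rip x y.
Proof. exact: (@ipZr _ _ (rmod X)). Qed.
Lemma ripBl x y z : rip (x - y) z = rip x z - rip y z.
Proof. exact: (@ipBl _ _ (rmod X)). Qed.
Lemma ripBr x y z : rip x (y - z) = rip x y - rip x z.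
Proof. exact: (@ipBr _ _ (rmod X)). Qed.

Lemma rip_inj x y : (forall z, rip x z = rip y z) -> x = y.
Proof. exact: (ip_inj rmod_hmod). Qed.

Lemma rip_lactN a x y : cs_norm (rip (lact a x) y) <= bm_norm x * bm_norm y * cs_norm a.
Proof.
apply: le_trans (rip_cs _ _) _; rewrite mulrAC; apply: ler_wpM2r; first exact: nm_ge0.
by rewrite mulrC lact_norm.
Qed.

Lemma lact_eq0 x : (forall b, lact b x = 0) -> x = 0.
Proof.
move=> h; apply: (nm0_eq0 NX); apply/eqP; rewrite -sqrf_eq0 bm_sql.
suff -> : lip x x = 0 by rewrite (nm0 NA).
by apply: cs_eq0; rewrite -(lh_ip_act XL) h lip0l.
Qed.

Hypothesis X_full : full_bimodule X.

(** Induction along fullness: A is the closed span of the left inner products. *)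
Lemma lip_ind (P : set A) : P 0 ->
  (forall (c : R[i]) a b, P a -> P b -> P (c *: a + b)) ->
  (forall x y, P (lip x y)) -> nclosure (@cs_norm R A) P `<=` P -> forall a, P a.
Proof.
move=> P0 PL PG Pc a; have : setT a by [].
rewrite -X_full.1; apply: closed_span_ind => //.
by move=> _ [x _] [y _] <-; exact: PG.
Qed.

(** Induction along non-degeneracy: X is the closed span of A X. *)
Lemma lact_ind (P : set X) : P 0 ->
  (forall (c : R[i]) x y, P x -> P y -> P (c *: x + y)) ->
  (forall a x, P (lact a x)) -> nclosure (@bm_norm R A X) P `<=` P -> forall x, P x.
Proof.
move=> P0 PL PG Pc x; have : setT x by [].
rewrite -(lh_nondeg XL); apply: closed_span_ind => //.
by move=> _ [a _] [y _] <-; exact: PG.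
Qed.

(** The left action is by adjointable operators for the right inner product,
    which the compatibility of the inner products gives on a = lip u v. *)
Lemma lact_adjoint a : @adjoint_pair R A (rmod X) (rmod X) (lact a) (lact (cs_star a)).
Proof.
move=> x y /=; move: a; apply: lip_ind.
- by rewrite cs_star0 !lact0l rip0l rip0r.
- move=> c a b ha hb.
  rewrite (cs_starD AP) (cs_starZ AP) !lactDl !lactZl.
  by rewrite ripDl ripZl ripDr ripZr ha hb.
- move=> u v; rewrite -(lh_ip_star XL) !(hb_compat (hbP X)) rip_ractl (rh_ip_act XR).
  by rewrite -(ipr_star (rh_ip XR)).
have K0 : 0 <= bm_norm x * bm_norm y by rewrite mulr_ge0 // (nm_ge0 NX).
apply: (eq_nclosure NA K0 _ _ NA) => a b.
  by rewrite -ripBl -lactBl; exact: rip_lactN.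
rewrite -ripBr -lactBl -cs_starN -(cs_starD AP) /=.
apply: le_trans (rip_cs _ _) _; rewrite -mulrA; apply: ler_wpM2l; first exact: nm_ge0.
by rewrite mulrC -[cs_norm (a - b)]cs_norm_starE lact_norm.
Qed.

Definition lact_op a : adj_op (rmod X) (rmod X) := mk_adj (lact_adjoint a).

Lemma lact_ract a x b : ract (lact a x) b = lact a (ract x b).
Proof.
apply: rip_inj => z; rewrite rip_ractl.
rewrite [rip (lact a x) z](lact_adjoint a) -rip_ractl.
exact: esym (lact_adjoint a _ _).
Qed.

Lemma adj_ract (T : adj_op (rmod X) (rmod X)) x b : T (ract x b) = ract (T x) b.
Proof.
apply: rip_inj => z; rewrite rip_ractl [LHS](adjP T) [rip (T x) z](adjP T).
exact: rip_ractl.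
Qed.

Lemma lact_faithful a : (forall x, lact a x = 0) -> a = 0.
Proof.
(* a lip x y = lip (a x) y vanishes, so a kills A by fullness. *)
move=> h; have h0 b : cs_mul a b = 0.
  move: b; apply: lip_ind.
  - exact: cs_mul0r.
  - by move=> c b b' hb hb'; rewrite cs_mulDr cs_mulZr hb hb' scaler0 addr0.
  - by move=> x y; rewrite -(lh_ip_act XL) h lip0l.
  apply: (eq_nclosure NA (nm_ge0 NA a) _ _ NA) => x y.
    by rewrite -cs_mulNr -cs_mulDr; exact: cs_normM.
  by rewrite subrr (nm0 NA) mulr_ge0 // (nm_ge0 NA).
exact: cs_eq0r.
Qed.

Lemma lact_inj a b : (forall x, lact a x = lact b x) -> a = b.
Proof.
move=> h; apply/eqP; rewrite -subr_eq0; apply/eqP/lact_faithful => x.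
by rewrite lactBl h subrr.
Qed.

(** * Compact operators and multipliers *)

Notation opX := (adj_op (rmod X) (rmod X)).

(** For a finite list of pairs (u_i, v_i), the sum of the left inner products of
    T u_i and v_i.  If a is this sum for T = id, then the general one is T a for
    the action of L(X) on its ideal A. *)
Definition lip_sum (T : X -> X) (l : seq (X * X)) : A := \sum_(p <- l) lip (T p.1) p.2.

Let hX := rmod_hmod.

Lemma lip_sum_sq (T : opX) l :
  cs_mul (cs_star (lip_sum T l)) (lip_sum T l) =
  cs_mul (cs_star (lip_sum id l)) (lip_sum (adj_comp (adj T) T) l).
Proof.
rewrite /lip_sum !cs_star_sum !cs_mul_suml; apply: eq_bigr => p _.
rewrite !cs_mul_sumr; apply: eq_bigr => q _ /=.
rewrite -!(lh_ip_star XL) -!(lh_ip_act XL) !(hb_compat (hbP X)).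
by rewrite [rip (T p.1) _](adjP T).
Qed.

(** Let T_0 = T and let T_(n+1) be the product of the adjoint of T_n with T_n.
    The norms s_n of the sums for T_n satisfy s_n ^ 2 <= s s_(n+1), where s is
    the norm of the sum for the identity, and they are bounded because the
    list is finite.  So s_0 <= s. *)
Lemma lip_sum_contract (T : opX) l : opnorm T <= 1 ->
  cs_norm (lip_sum T l) <= cs_norm (lip_sum id l).
Proof.
move=> T1; pose P n : opX := iter n (fun S => adj_comp (adj S) S) T.
have PS n : P n.+1 = adj_comp (adj (P n)) (P n) by [].
have P1 n : opnorm (P n) <= 1.
  elim: n => [|n IH] //; rewrite PS (opnorm_C hX hX).
  by rewrite expr_le1 // (opnorm_ge0 hX hX).
have sqP n : cs_norm (lip_sum (P n) l) ^+ 2 <=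
    cs_norm (lip_sum id l) * cs_norm (lip_sum (P n.+1) l).
  rewrite -(cs_norm_star AP) lip_sum_sq; apply: le_trans (cs_normM AP _ _) _.
  by rewrite cs_norm_starE.
pose K := \sum_(p <- l) bm_norm p.1 * bm_norm p.2.
have bK n : cs_norm (lip_sum (P n) l) <= K.
  apply: le_trans (nm_sum NA _ _ _) _; apply: ler_sum => p _.
  apply: le_trans (lip_cs _ _) _; apply: ler_wpM2r; first exact: nm_ge0.
  apply: le_trans (opnorm_le hX hX (P n) p.1) _.
  by rewrite ler_piMl // (nm_ge0 NX).
set s := cs_norm (lip_sum id l) in sqP *.
have [s0|s0] := eqVneq s 0.
  by have := sqP 0%N; rewrite s0 mul0r; have := nm_ge0 NA (lip_sum (P 0%N) l); rewrite /P /=; nra.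
have sp : 0 < s by rewrite lt0r s0 (nm_ge0 NA).
rewrite -[leRHS]mul1r -ler_pdivrMr //.
apply: (@square_bounded _ (fun n => cs_norm (lip_sum (P n) l) / s) (K / s)) => n.
- by rewrite divr_ge0 // ?(nm_ge0 NA) // ltW.
- by rewrite expr2 mulrA ler_pM2r ?invr_gt0 // mulrAC ler_pdivrMr // -expr2 mulrC.
by rewrite ler_pM2r // invr_gt0.
Qed.

Lemma lip_sumZ (T : opX) (c : R[i]) l : lip_sum (c *: T : opX) l = c *: lip_sum T l.
Proof. by rewrite /lip_sum scaler_sumr; apply: eq_bigr => p _; rewrite -lipZl. Qed.

Lemma lip_sum_norm (T : opX) l : cs_norm (lip_sum T l) <= opnorm T * cs_norm (lip_sum id l).
Proof.
have [t0|t0] := eqVneq (opnorm T) 0.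
  have T0 : T = 0 by exact: (nm0_eq0 (opnorm_is_norm hX hX)).
  rewrite t0 mul0r; suff -> : lip_sum T l = 0 by rewrite (nm0 NA).
  by rewrite T0 /lip_sum big1 // => p _; exact: lip0l.
have tp : 0 < opnorm T by rewrite lt0r t0 (opnorm_ge0 hX hX).
have ti : 0 <= (opnorm T)^-1 by rewrite invr_ge0 ltW.
have n1 : opnorm (((opnorm T)^-1)%:C%C *: T : opX) <= 1.
  have := nmZr (opnorm_is_norm hX hX) (opnorm T)^-1 T.
  by rewrite ger0_norm // mulVf // => ->.
have := lip_sum_contract l n1; rewrite lip_sumZ (nmZr NA) ger0_norm //.
by rewrite mulrC ler_pdivrMr // mulrC.
Qed.

Lemma lip_sum_lact (T : opX) l x : lact (lip_sum T l) x = T (lact (lip_sum id l) x).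
Proof.
elim: l => [|p l IH]; first by rewrite /lip_sum !big_nil !lact0l (pair0 hX (adjP T)).
have Tadd (y z : X) : T (y + z) = T y + T z.
  by have := pair_linear hX 1 (y : rmod X) z (adjP T); rewrite !scale1r.
rewrite /lip_sum !big_cons !lactDl Tadd; congr (_ + _); last exact: IH.
by rewrite !(hb_compat (hbP X)) adj_ract.
Qed.

Lemma lip_sum_diff (T : opX) l l' :
  lip_sum T l - lip_sum T l' = lip_sum T (l ++ [seq (- p.1, p.2) | p <- l']).
Proof.
rewrite /lip_sum big_cat big_map -sumrN /=; congr (_ + _); apply: eq_bigr => p _ /=.
by rewrite -[- p.1]scaleN1r (pairZ hX _ _ (adjP T)) scaleN1r lipNl.
Qed.

Lemma lip_sum_dense a e : 0 < e -> exists l, cs_norm (a - lip_sum id l) < e.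
Proof.
move=> e0; have : setT a by []; rewrite -X_full.1 => /(_ e e0)[s [n [c [v [Sv ->]]]] hs].
suff [l hl] : exists l, \sum_(i < n) c i *: v i = lip_sum id l by exists l; rewrite -hl.
apply: (big_ind (fun s => exists l, s = lip_sum id l)) => [|_ _ [l ->] [l' ->]|i _].
- by exists [::]; rewrite /lip_sum big_nil.
- by exists (l ++ l'); rewrite /lip_sum big_cat.
have [x _ [y _ <-]] := Sv i; exists [:: (c i *: x, y)].
by rewrite /lip_sum big_cons big_nil addr0 lipZl.
Qed.

(** A is an ideal of L(X): T composed with the action of a is again the action
    of an element of A, of norm at most |T| |a|. *)
Lemma compact_ex (T : opX) a :
  {c : A | (forall x, lact c x = T (lact a x)) /\ cs_norm c <= opnorm T * cs_norm a}.
Proof.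
apply: cid; have T0 : 0 <= opnorm T by exact: (opnorm_ge0 hX hX).
have ex n : exists l, cs_norm (a - lip_sum id l) < n.+1%:R^-1.
  by apply: lip_sum_dense; rewrite invr_gt0 ltr0Sn.
pose l n := projT1 (cid (ex n)).
have hl n : cs_norm (a - lip_sum id (l n)) < n.+1%:R^-1 := projT2 (cid (ex n)).
pose u n := lip_sum T (l n).
have idE l' : lip_sum id l' = lip_sum (adj_one (rmod X)) l' by [].
have T2 : 0 <= opnorm T * 2 by rewrite mulr_ge0.
have hu m n : (n <= m)%N -> cs_norm (u m - u n) <= opnorm T * 2 * n.+1%:R^-1.
  move=> nm; rewrite /u lip_sum_diff; apply: le_trans (lip_sum_norm _ _) _.
  rewrite -mulrA; apply: ler_wpM2l => //.
  rewrite idE -lip_sum_diff -!idE.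
  apply: le_trans (nmT NA a _ _) _; rewrite mulr_natl mulr2n lerD // ?(ltW (hl _)) //.
  rewrite (nmB NA); apply: le_trans (ltW (hl m)) _.
  by rewrite lef_pV2 ?posrE ?ltr0Sn // ler_nat.
have [c hc] := banach_complete (cs_banach AP) (rateM T2 (@rate_inv R)) hu.
exists c; split=> [x|].
  have K0 : 0 <= opnorm T * 3 * bm_norm x by rewrite !mulr_ge0 // (nm_ge0 NX).
  apply: (nm_rate_eq NX (rateM K0 (@rate_inv R))) => n.
  apply: le_trans (nmT NX (lact (u n) x) _ _) _.
  have e1 : lact (u n) x - T (lact a x) = T (lact (lip_sum id (l n) - a) x).
    by rewrite /u lip_sum_lact lactBl [RHS](pairB hX _ _ (adjP T)).
  rewrite e1 -lactBl.
  have -> : opnorm T * 3 * bm_norm x * n.+1%:R^-1 =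
    opnorm T * 2 * n.+1%:R^-1 * bm_norm x + opnorm T * (n.+1%:R^-1 * bm_norm x) by ring.
  apply: lerD.
    apply: le_trans (lact_norm _ _) _; apply: ler_wpM2r; first exact: nm_ge0.
    by rewrite (nmB NA).
  apply: le_trans (opnorm_le hX hX T _) _; apply: ler_wpM2l => //.
  apply: le_trans (lact_norm _ _) _; apply: ler_wpM2r; first exact: nm_ge0.
  by rewrite (nmB NA) ltW.
rewrite -subr_le0.
apply: (@rate_le0 _ (fun n => opnorm T * 3 * n.+1%:R^-1)).
  by apply: rateM (@rate_inv R); rewrite mulr_ge0.
move=> n; rewrite lerBlDr.
have h1 := hc n; have h2 := lip_sum_norm T (l n); have h3 := hl n.
have h4 := nmT NA (u n) c 0; rewrite !subr0 (nmB NA) in h4.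
have h5 := nmT NA a (lip_sum id (l n)) 0; rewrite !subr0 (nmB NA) in h5.
move: h1 h2 h3 h4 h5; rewrite -/(u n); set q : R := n.+1%:R^-1; set v := cs_norm (lip_sum id _).
move=> h1 h2 h3 h4 h5.
have h6 : opnorm T * v <= opnorm T * (q + cs_norm a).
  by apply: ler_wpM2l => //; apply: le_trans h5 _; rewrite lerD2r ltW.
move: h1 h2 h4 h6; rewrite mulrDr; lra.
Qed.

(** The product T a in A, for T an operator on X and a in A. *)
Definition compact (T : opX) a : A := sval (compact_ex T a).

Lemma compactE (T : opX) a x : lact (compact T a) x = T (lact a x).
Proof. exact: (svalP (compact_ex T a)).1. Qed.

Lemma compact_norm (T : opX) a : cs_norm (compact T a) <= opnorm T * cs_norm a.
Proof. exact: (svalP (compact_ex T a)).2. Qed.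

Lemma compact_adjoint (T : opX) :
  @adjoint_pair R A (self_mod A) (self_mod A) (compact T) (compact (adj T)).
Proof.
move=> a b /=; apply: lact_inj => x; rewrite !(lh_actM XL) compactE.
apply: rip_inj => z.
rewrite [LHS](lact_adjoint (cs_star (compact T a))) (cs_starK AP) compactE.
rewrite [RHS](lact_adjoint (cs_star a)) (cs_starK AP).
exact: esym (adjoint_pair_sym (adjP T) _ _).
Qed.

(** The multiplier of A induced by an operator on X. *)
Definition compact_mult (T : opX) : mult_alg A := mk_adj (compact_adjoint T).

(** * Extension of the left action to M(A) *)

Let hA := self_hmod A.
Notation opA := (adj_op (self_mod A) (self_mod A)).
Implicit Types M : opA.

(** [y] is the value at [x] of the operator on X induced by the multiplier [M]. *)
Definition is_lift M x y := forall b, lact b y = lact (rmul M b) x.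

Lemma is_lift_lact M a x : is_lift M (lact a x) (lact (M a) x).
Proof. by move=> b; rewrite -!(lh_actM XL) rmulE. Qed.

Lemma is_lift_uniq M x y y' : is_lift M x y -> is_lift M x y' -> y = y'.
Proof.
move=> h h'; apply/eqP; rewrite -subr_eq0; apply/eqP/lact_eq0 => b.
by rewrite lactBr h h' subrr.
Qed.

Lemma is_lift_lin M (c : R[i]) x x' y y' :
  is_lift M x y -> is_lift M x' y' -> is_lift M (c *: x + x') (c *: y + y').
Proof. by move=> h h' b; rewrite !lactDr !lactZr h h'. Qed.

Lemma is_liftB M x x' y y' :
  is_lift M x y -> is_lift M x' y' -> is_lift M (x - x') (y - y').
Proof. by move=> h h' b; rewrite !lactBr h h'. Qed.

(** Boundedness follows from the operator identity
    lip y y = M (lip x x) M* in M(A). *)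
Lemma is_lift_norm M x y : is_lift M x y -> bm_norm y <= opnorm M * bm_norm x.
Proof.
move=> h; have M0 : 0 <= opnorm M by exact: (opnorm_ge0 hA hA).
rewrite -ler_sqr ?nnegrE ?mulr_ge0 ?(nm_ge0 NX) // exprMn !bm_sql.
set g := lip x x.
have e c : cs_mul (lip y y) c = M (cs_mul g (adj M c)).
  (* Compare after multiplication by b: both sides become lip (b y) (c* y). *)
  apply/eqP; rewrite -subr_eq0; apply/eqP/cs_eq0l => b.
  rewrite cs_mulDr cs_mulNr; apply/eqP; rewrite subr_eq0; apply/eqP.
  rewrite -rmulE (cs_mulA AP) -(lh_ip_act XL) -[c in LHS](cs_starK AP) -lip_lactr !h.
  by rewrite (lh_ip_act XL) lip_lactr /rmul !(cs_starK AP).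
rewrite -opnorm_iotaA.
have K0 : 0 <= opnorm M ^+ 2 * cs_norm g by rewrite mulr_ge0 ?sqr_ge0 ?(nm_ge0 NA).
apply: (opnorm_lub hA hA (T := iotaA (lip y y))) => // c /=.
rewrite e; apply: le_trans (opnorm_le hA hA M _) _.
rewrite expr2 -!mulrA; apply: ler_wpM2l => //.
apply: le_trans (cs_normM AP _ _) _; rewrite mulrCA; apply: ler_wpM2l; first exact: nm_ge0.
exact: (adj_le hA hA M c).
Qed.

(** The vectors that have a lift form a closed subspace containing A X. *)
Lemma is_lift_ex M x : {y | is_lift M x y}.
Proof.
apply: cid; move: x; apply: lact_ind.
- by exists 0 => b; rewrite !lact0r.
- by move=> c x x' [y h] [y' h']; exists (c *: y + y'); exact: is_lift_lin.
- by move=> a x; exists (lact (M a) x); exact: is_lift_lact.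
move=> x hx.
have ex n : exists p : X * X, is_lift M p.1 p.2 /\ bm_norm (x - p.1) < n.+1%:R^-1.
  have [|s [y hy] hs] := hx n.+1%:R^-1; first by rewrite invr_gt0 ltr0Sn.
  by exists (s, y).
pose u n := (projT1 (cid (ex n))).1; pose v n := (projT1 (cid (ex n))).2.
have huv n : is_lift M (u n) (v n) := (projT2 (cid (ex n))).1.
have hu n : bm_norm (x - u n) < n.+1%:R^-1 := (projT2 (cid (ex n))).2.
have M0 : 0 <= opnorm M by exact: (opnorm_ge0 hA hA).
have hv m n : (n <= m)%N -> bm_norm (v m - v n) <= opnorm M * 2 * n.+1%:R^-1.
  move=> nm; apply: le_trans (is_lift_norm (is_liftB (huv m) (huv n))) _.
  rewrite -mulrA; apply: ler_wpM2l => //.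
  apply: le_trans (nmT NX x _ _) _; rewrite mulr_natl mulr2n lerD // ?(ltW (hu _)) //.
  rewrite (nmB NX); apply: le_trans (ltW (hu m)) _.
  by rewrite lef_pV2 ?posrE ?ltr0Sn // ler_nat.
have M2 : 0 <= opnorm M * 2 by rewrite mulr_ge0.
have [y hy] := banach_complete (rh_banach XR) (rateM M2 (@rate_inv R)) hv.
exists y => b.
have K0 : 0 <= cs_norm b * (opnorm M * 2) + cs_norm (rmul M b).
  by rewrite addr_ge0 ?(nm_ge0 NA) // mulr_ge0 ?(nm_ge0 NA).
apply: (nm_rate_eq NX (rateM K0 (@rate_inv R))) => n.
apply: le_trans (nmT NX (lact b (v n)) _ _) _.
have -> : lact b (v n) - lact (rmul M b) x = lact (rmul M b) (u n - x).
  by rewrite huv lactBr.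
rewrite -lactBr mulrDl -mulrA; apply: lerD; apply: le_trans (lact_norm _ _) _.
  by apply: ler_wpM2l; rewrite ?(nm_ge0 NA) // (nmB NX).
by apply: ler_wpM2l; rewrite ?(nm_ge0 NA) // (nmB NX) ltW.
Qed.

(** The operator on X induced by a multiplier, as a function. *)
Definition lift M x : X := sval (is_lift_ex M x).
Lemma liftP M x : is_lift M x (lift M x).
Proof. exact: svalP (is_lift_ex M x). Qed.

Lemma lift_lact M a x : lift M (lact a x) = lact (M a) x.
Proof. exact: is_lift_uniq (liftP _ _) (is_lift_lact _ _ _). Qed.

Lemma liftL M (c : R[i]) x y : lift M (c *: x + y) = c *: lift M x + lift M y.
Proof. apply: is_lift_uniq (liftP _ _) _; exact: is_lift_lin (liftP _ _) (liftP _ _). Qed.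

Lemma lift_adjoint M : @adjoint_pair R A (rmod X) (rmod X) (lift M) (lift (adj M)).
Proof.
move=> x y /=; move: y; apply: lact_ind.
- rewrite rip0r; have -> : lift (adj M) 0 = 0.
    by apply: is_lift_uniq (liftP _ _) _ => b; rewrite !lact0r.
  by rewrite rip0r.
- by move=> c y y' h h'; rewrite liftL !ripDr !ripZr h h'.
- move=> b z; rewrite lift_lact -{1}[b](cs_starK AP).
  rewrite -[LHS](lact_adjoint (cs_star b)) liftP [LHS](lact_adjoint (rmul M _)).
  by rewrite /rmul !(cs_starK AP).
have K0 : 0 <= bm_norm x * opnorm M by rewrite mulr_ge0 ?(nm_ge0 NX) // (opnorm_ge0 hA hA).
have K1 : 0 <= bm_norm (lift M x) by exact: nm_ge0.
have K2 : 0 <= bm_norm x * opnorm M + bm_norm (lift M x) by rewrite addr_ge0.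
apply: (eq_nclosure NA K2 _ _ NX) => y y'; rewrite -ripBr.
  apply: le_trans (rip_cs _ _) _; apply: ler_wpM2r; first exact: nm_ge0.
  by rewrite lerDr.
apply: le_trans (rip_cs _ _) _; rewrite mulrDl -[leLHS]addr0; apply: lerD; last first.
  by rewrite mulr_ge0 // (nm_ge0 NX).
rewrite -mulrA; apply: ler_wpM2l; first exact: nm_ge0.
rewrite -(opnorm_adj hA hA M).
exact: is_lift_norm (is_liftB (liftP _ _) (liftP _ _)).
Qed.

(** The operator on X induced by a multiplier. *)
Definition lift_op M : opX := mk_adj (lift_adjoint M).

(** Operators on X are determined by their values on A X. *)
Lemma opX_ext (S T : opX) : (forall a x, S (lact a x) = T (lact a x)) -> S = T.
Proof.
move=> h; apply: adj_ext; apply: lact_ind => //.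
- by rewrite (pair0 hX (adjP S)) (pair0 hX (adjP T)).
- move=> c x y hx hy.
  rewrite [LHS](pair_linear hX c (x : rmod X) y (adjP S)).
  by rewrite [RHS](pair_linear hX c (x : rmod X) y (adjP T)) hx hy.
have K0 : 0 <= opnorm S + opnorm T by rewrite addr_ge0 // (opnorm_ge0 hX hX).
apply: (eq_nclosure NX K0 _ _ NX) => x y.
  rewrite -[X in bm_norm X](pairB hX (x : rmod X) y (adjP S)).
  apply: le_trans (opnorm_le hX hX S _) _; apply: ler_wpM2r; first exact: nm_ge0.
  by rewrite lerDl (opnorm_ge0 hX hX).
rewrite -[X in bm_norm X](pairB hX (x : rmod X) y (adjP T)).
apply: le_trans (opnorm_le hX hX T _) _; apply: ler_wpM2r; first exact: nm_ge0.
by rewrite lerDr (opnorm_ge0 hX hX).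
Qed.

Lemma lift_op_extends : extends_phi (X := X) lift_op.
Proof.
split.
- split.
  + move=> c M N; apply: opX_ext => a x /=.
    by rewrite [LHS]lift_lact /= lactDl lactZl -!lift_lact.
  + move=> M N; apply: opX_ext => a x /=.
    by rewrite !lift_lact.
  move=> M; apply: adj_ext => x.
  by rewrite (adj_uniq hX (T := lift_op M) (lift_adjoint M)).
- exists compact_mult => [M|T].
    apply: adj_ext => a; apply: lact_inj => x.
    by rewrite compactE /= lift_lact.
  apply: opX_ext => a x; rewrite /= lift_lact.
  exact: compactE.
move=> a x; suff -> : lift_op (iotaA a) = lact_op a by [].
by apply: opX_ext => b y; rewrite /= lift_lact /= (lh_actM XL).
Qed.

Notation phib := (@phibar R A X).

Lemma phibar_extends : extends_phi phib.
Proof. exact: (@xgetPex _ _ (@extends_phi R A X) (ex_intro _ _ lift_op_extends)). Qed.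

(** Any extension of the left action is determined: M times the image of a is
    the image of M(a). *)
Lemma phibar_lact M a x : phib M (lact a x) = lact (M a) x.
Proof.
have [hom _ ext] := phibar_extends.
rewrite -(ext a x) -(ext (M a) x) -[LHS]/((cs_mul (phib M) (phib (iotaA a)) : opX) x).
rewrite -(sh_mul hom); congr ((phib _ : opX) x).
by apply: adj_ext => b; exact: mult_mulr.
Qed.

Lemma phibarE M : phib M = lift_op M.
Proof. by apply: opX_ext => a x; rewrite phibar_lact /= lift_lact. Qed.

Lemma phibar_inj : injective phib.
Proof. by have [_ /bij_inj] := phibar_extends. Qed.

Lemma phibar_invK (u : adj_alg (rmod X)) : phib (phibar_inv u) = u.
Proof.
have [_ [g _ gK] _] := phibar_extends.
exact: (@xgetPex _ _ [set m | phib m = u] (ex_intro _ (g u) (gK u))).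
Qed.

Lemma phibar_norm M : opnorm (phib M : opX) = opnorm M.
Proof.
have P0 : 0 <= opnorm (phib M : opX) by exact: (opnorm_ge0 hX hX).
apply/eqP; rewrite eq_le; apply/andP; split.
  apply: (opnorm_lub hX hX); first exact: (opnorm_ge0 hA hA).
  by move=> x; rewrite phibarE; exact: is_lift_norm (liftP _ _).
apply: (opnorm_lub hA hA) => // a.
suff -> : M a = compact (phib M) a by exact: compact_norm.
by apply: lact_inj => x; rewrite compactE phibar_lact.
Qed.

(** * The multiplier bimodule as an essential extension *)

Notation opAX := (adj_op (self_mod A) (rmod X)).
Implicit Types S T : opAX.

(** S* S is of the form b* b in M(A). *)
Lemma op_pos_rip T : @cs_pos _ (mult_alg A) (adj_comp (adj T) T).
Proof.
have [k [hk e]] : exists k : opA, adj k = k /\ adj_comp (adj T) T = adj_comp k k.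
  apply: (op_pos hA) => [a||a].
  - by exists a.
  - by rewrite (adj_compE hA) (adj_adjK hX).
  have -> : ipm_ip a (adj_comp (adj T) T a) = rip (T a) (T a).
    exact: esym (adjP T a (T a)).
  exact: (rh_ip_pos XR).
by exists k; rewrite e /= hk.
Qed.

(** T T* is the square of a self-adjoint operator in L(X). *)
Lemma op_pos_lip T : exists k : opX, adj k = k /\ adj_comp T (adj T) = adj_comp k k.
Proof.
apply: (op_pos hX) => [x||x].
- exact: (rh_ip_pos XR).
- by rewrite (adj_compE hX) (adj_adjK hX).
exists (adj T x).
exact: esym (adjoint_pair_sym (adjP T) x (adj T x)).
Qed.

Lemma phibar1 : phib (adj_one (self_mod A)) = adj_one (rmod X).
Proof. by apply: opX_ext => a x; rewrite phibar_lact. Qed.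

Lemma mult_right_hilbert :
  @right_hilbert R (mult_alg A) (adj_op (self_mod A) (rmod X))
    (@bm_norm _ _ (mult_bimod X)) (@ract _ _ (mult_bimod X)) (@rip _ _ (mult_bimod X)).
Proof.
have NT := opnorm_is_norm hA hX.
split.
- exact: opnorm_banach.
- by move=> m c S T; exact: adj_compDl.
- by move=> T c m m'; exact: (adj_compDr hX).
- by move=> T m m'; exact: adj_ext.
- apply/seteqP; split=> // T _; apply: (sub_closed_span NT).
  by exists T => //; exists (adj_one (self_mod A)) => //; exact: adj_comp1r.
- split=> [S c T T'|S T]; first exact: (adj_compDr hA).
  have e : adj (adj_comp (adj S) T) = adj_comp (adj T) S.
    by rewrite (adj_compE hA) (adj_adjK hX).
  exact: esym e.
- by move=> S T m; exact: adj_ext.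
- exact: op_pos_rip.
move=> T; have e : opnorm T = Num.sqrt (opnorm (adj_comp (adj T) T)).
  by rewrite (opnorm_C hA hX) sqrtr_sqr ger0_norm // (opnorm_ge0 hA hX).
exact: e.
Qed.

Lemma mult_left_hilbert :
  @left_hilbert R (mult_alg A) (adj_op (self_mod A) (rmod X))
    (@bm_norm _ _ (mult_bimod X)) (@lact _ _ (mult_bimod X)) (@lip _ _ (mult_bimod X)).
Proof.
have NT := opnorm_is_norm hA hX.
have [[lin mul star] _ _] := phibar_extends.
split.
- exact: opnorm_banach.
- by move=> T c m m' /=; rewrite lin; exact: adj_compDl.
- by move=> m c S T; exact: (adj_compDr hX).
- by move=> m m' T /=; rewrite mul; exact: adj_ext.
- apply/seteqP; split=> // T _; apply: (sub_closed_span NT).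
  exists (adj_one (self_mod A)) => //; exists T => //.
  by rewrite /= phibar1; exact: adj_comp1l.
- move=> T c S S' /=; apply: phibar_inj; rewrite lin !phibar_invK; exact: adj_compDl.
- move=> S T; apply: phibar_inj; rewrite star !phibar_invK.
  have e : adj (adj_comp S (adj T)) = adj_comp T (adj S).
    by rewrite (adj_compE hX) (adj_adjK hX).
  exact: esym e.
- move=> m S T; apply: phibar_inj; rewrite mul !phibar_invK; exact: adj_ext.
- move=> T; have [k [hk e]] := op_pos_lip T.
  exists (phibar_inv k); apply: phibar_inj.
  rewrite mul star !phibar_invK e.
  by rewrite -[RHS]/(adj_comp (adj k) k) hk.
move=> T; have e : opnorm T = Num.sqrt (opnorm (phibar_inv (adj_comp T (adj T)) : opA)).
  rewrite -phibar_norm phibar_invK -{2}(adj_adjK hX T) (opnorm_C hX hA).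
  by rewrite (opnorm_adj hA hX) sqrtr_sqr ger0_norm // (opnorm_ge0 hA hX).
exact: e.
Qed.

Lemma mult_hilbert_bimodule : is_hilbert_bimodule (mult_bimod X).
Proof.
split; [exact: mult_right_hilbert|exact: mult_left_hilbert|].
by move=> S T U /=; rewrite phibar_invK; exact: adj_ext.
Qed.

Lemma adj_iotaX x y : adj (iotaX x) y = rip x y.
Proof. exact: (adj_uniq hA (T := iotaX x) (iotaX_adjoint x)). Qed.

Lemma phibar_iotaA a x : (phib (iotaA a) : opX) x = lact a x.
Proof. by have [_ _ ext] := phibar_extends; exact: ext. Qed.

Lemma iotaX_linear : linear (@iotaX R A X : X -> mult_bimod X).
Proof.
move=> c x y; apply: adj_ext => b.
exact: (rh_act_linearl XR).
Qed.

Lemma iotaX_ract x a : iotaX (ract x a) = adj_comp (iotaX x) (iotaA a).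
Proof. by apply: adj_ext => b /=; rewrite (rh_actM XR). Qed.

Lemma iotaX_lact a x : iotaX (lact a x) = adj_comp (phib (iotaA a)) (iotaX x).
Proof. by apply: adj_ext => b /=; rewrite phibar_iotaA lact_ract. Qed.

Lemma iota_morphism :
  @is_bimod_morphism R A (mult_alg A) X (mult_bimod X) (@iotaX R A X) (@iotaA R A).
Proof.
split.
- exact: iotaX_linear.
- exact: iotaA_star_hom.
- exact: iotaX_ract.
- exact: iotaX_lact.
- move=> x y; apply: adj_ext => b.
  rewrite -[RHS]/(adj (iotaX x) (ract y b)) adj_iotaX (rh_ip_act XR).
  by [].
move=> x y; apply: phibar_inj; rewrite [RHS]phibar_invK; apply: adj_ext => z.
rewrite phibar_iotaA -[RHS]/(ract x (adj (iotaX y) z)) adj_iotaX.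
exact: (hb_compat (hbP X)).
Qed.

Lemma opnorm_iotaX x : opnorm (iotaX x) <= bm_norm x.
Proof.
apply: (opnorm_lub hA hX); first exact: nm_ge0.
by move=> a; rewrite /= mulrC; exact: ract_norm.
Qed.

(** Elements of A act on M(X) from the left by <u, v> T = u (T* v)*, so A M(X) is
    contained in the closed span of M(X) A.  For the converse, T a is the image
    of the vector T(a), which is a limit of sums of elements of A X. *)
Lemma iotaA_invariant :
  @invariant_ideal R (mult_alg A) (mult_bimod X) (range (@iotaA R A)).
Proof.
have NT := opnorm_is_norm hA hX.
have [[lin _ _] _ _] := phibar_extends.
have compL (T : opAX) : linear (fun S : opX => adj_comp S T : opAX).
  by move=> k S S'; exact: adj_compDl.
apply/seteqP; split; apply: (closed_span_sub NT).
  move=> _ [_ [a _ <-] [T _ <-]] /=; move: a; apply: lip_ind.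
  - rewrite iotaA0 (linear_at0 lin).
    rewrite (linear_at0 (compL T)).
    exact: (closed_span0 _ NT).
  - move=> c a b ha hb; rewrite iotaA_linear lin adj_compDl.
    exact: (closed_span_lin _ NT).
  - move=> u v; apply: (sub_closed_span NT).
    exists (iotaX u) => //; exists (iotaA (cs_star (adj T v))); first by exists (cs_star (adj T v)).
    apply: adj_ext => b /=; rewrite phibar_iotaA (hb_compat (hbP X)).
    congr (ract u _); exact: (adjoint_pair_sym (adjP T) v b).
  move=> a ha; apply: (closed_span_closed NT) => e e0.
  have T1 : 0 < opnorm T + 1 by rewrite ltr_wpDl // (opnorm_ge0 hA hX).
  have [b hb ab] := ha (e / (opnorm T + 1)) (divr_gt0 e0 T1).
  exists (adj_comp (phib (iotaA b)) T) => //.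
  have -> : adj_comp (phib (iotaA a)) T - adj_comp (phib (iotaA b)) T =
      adj_comp (phib (iotaA (a - b))) T.
    rewrite iotaAB (linear_subr _ _ lin).
    by rewrite -(linear_subr _ _ (compL T)).
  apply: le_lt_trans (opnorm_comp hA hX hX _ _) _.
  rewrite phibar_norm opnorm_iotaA.
  move: ab; rewrite ltr_pdivlMr // => ab; apply: le_lt_trans ab.
  by apply: ler_wpM2l; [exact: nm_ge0|rewrite lerDl].
move=> _ [T _ [_ [a _ <-] <-]] /=.
have -> : adj_comp T (iotaA a) = iotaX (T a).
  apply: adj_ext => b /=; apply: rip_inj => z.
  rewrite [LHS](adjP T) rip_ractl [rip (T a) z](adjP T) /=.
  by rewrite (cs_starM AP) (cs_mulA AP).
move: (T a); apply: lact_ind.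
- rewrite (linear_at0 iotaX_linear); exact: (closed_span0 _ NT).
- by move=> c x y hx hy; rewrite iotaX_linear; exact: (closed_span_lin _ NT).
- move=> b x; apply: (sub_closed_span NT); rewrite iotaX_lact.
  by exists (iotaA b); [exists b|exists (iotaX x)].
move=> x hx; apply: (closed_span_closed NT) => e e0.
have [y hy xy] := hx e e0; exists (iotaX y) => //.
by rewrite -(linear_subr _ _ iotaX_linear); apply: le_lt_trans (opnorm_iotaX _) _.
Qed.

End bimodule.

Theorem corollary3p3 (R : realType) (A : cstarAlg R) (X : hilbertBimod A)
  (X_full : full_bimodule X) :
  @is_essential_extension R A (mult_alg A) X (mult_bimod X)
    (@iotaX R A X) (@iotaA R A).
Proof.
split; last exact: iotaA_essential.
split.
- exact: adj_alg_cstar (self_hmod A).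
- exact: mult_hilbert_bimodule.
- exact: iotaA_inj.
- exact: iota_morphism.
- exact: iotaA_ideal.
exact: iotaA_invariant.
Qed.
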